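(* Let $(\Omega,\mathcal F,\mathbb P)$ be a non-atomic probability space, $d\ge 1$, $p\ge 1$, $X\in L^\infty(\Omega,\mathbb R^d)$ with law $m_0$, and let $\mathbf X=(X_1,\dots,X_p)\in L^\infty(\Omega,\mathbb R^d)^p$ with $\sum_{i=1}^p X_i=X$. Let $B\subset\mathbb R^d$ be a closed ball centered at $0$ such that $\mathbf X\in B^p$ almost surely, and let $\gamma_0=\mathcal L(\mathbf X)$ be the joint law of $\mathbf X$ (so $\gamma_0\in\mathcal M_B(m_0)$). Let $w=(w_1,\dots,w_p)$ be a family of strictly convex functions in $C^1(B)$. Then there exists $\gamma\in\mathcal M(m_0)$ that is $w$-comonotone and dominates $\gamma_0$. Moreover, if $\gamma_0$ is not itself $w$-comonotone, then $\gamma$ strictly dominates $\gamma_0$.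
   Context: $\mathcal M(m_0)$ is the set of compactly supported probability measures $\gamma$ on $(\mathbb R^d)^p$ such that the image of $\gamma$ under $(x_1,\dots,x_p)\mapsto\sum_{i=1}^p x_i$ is $m_0$, and $\mathcal M_B(m_0)=\{\gamma\in\mathcal M(m_0):\gamma(B^p)=1\}$. $pB=\{px:x\in B\}$. $\mathcal C$ is the cone of convex continuous real-valued functions on $B$. Dominance: for $\gamma,\pi\in\mathcal M_B(m_0)$, $\gamma$ dominates $\pi$ if $\int_{B^p}\sum_{i=1}^p\varphi_i(x_i)\,d\gamma(x)\le\int_{B^p}\sum_{i=1}^p\varphi_i(x_i)\,d\pi(x)$ for all $(\varphi_1,\dots,\varphi_p)\in\mathcal C^p$; $\gamma$ strictly dominates $\pi$ if, in addition, the inequality is strict whenever all the $\varphi_i\in\mathcal C$ are strictly convex. For a family $\psi=(\psi_1,\dots,\psi_p)$ of strictly convex continuous functions on $B$ and $x\in pB$, $T_\psi(x)=(T^1_\psi(x),\dots,T^p_\psi(x))$ denotes the unique minimizer of $\sum_{i=1}^p\psi_i(y_i)$ over $(y_1,\dots,y_p)\in B^p$ with $\sum_{i=1}^p y_i=x$. $\gamma_\psi\in\mathcal M_B(m_0)$ is the image of $m_0$ under $T_\psi$, i.e. $\int_{B^p}f\,d\gamma_\psi=\int_{pB}f(T_\psi(x))\,dm_0(x)$ for all $f\in C(B^p)$. $\gamma\in\mathcal M_B(m_0)$ is $w$-strictly comonotone if $\gamma=\gamma_\psi$ for some family $\psi=(\psi_1,\dots,\psi_p)$ of convex continuous functions on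 $B$ with $\psi_i-w_i\in\mathcal C$ for every $i$ (each such $\psi_i$ is then strictly convex). $\gamma\in\mathcal M_B(m_0)$ is $w$-comonotone if there is a sequence of $w$-strictly comonotone elements of $\mathcal M_B(m_0)$ converging to $\gamma$ weakly star (i.e. against every $f\in C(B^p)$). *)

(* Defs.v *)
From HB Require Import structures.
From mathcomp Require Import all_boot all_order all_algebra.
From mathcomp Require Import all_classical all_reals all_analysis.

Set Implicit Arguments.
Unset Strict Implicit.
Unset Printing Implicit Defensive.
Import Order.TTheory GRing.Theory Num.Theory.
Import numFieldNormedType.Exports.
Local Open Scope classical_set_scope.
Local Open Scope ring_scope.

(* R^d is 'rV[R]_d and (R^d)^p is 'M[R]_(p, d), the i-th component of x being
   row i x. Both carry the Borel sigma-algebra. *)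
Section borel_matrix.
Variables (R : realType) (m n : nat).

HB.instance Definition _ := Measurable.copy 'M[R]_(m, n)
  (g_sigma_algebraType (@open 'M[R]_(m, n))).

End borel_matrix.

Section probability_notions.
Variables (R : realType).

Definition nonatomic d (T : measurableType d) (P : probability T R) : Prop :=
  forall A : set T, measurable A -> (0 < P A)%E ->
  exists A' : set T,
    [/\ A' `<=` A, measurable A', (0 < P A')%E & (P A' < P A)%E].

Definition in_Linfty d (T : measurableType d) (P : probability T R) m n
    (X : T -> 'M[R]_(m, n)) : Prop :=
  forall i j, (fun t => X t i j) \in Lfun P +oo%E.

Definition support_of m n (mu : probability 'M[R]_(m, n) R) :
    set 'M[R]_(m, n) :=
  [set x | forall U : set 'M[R]_(m, n), open U -> U x -> (0 < mu U)%E].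

End probability_notions.

Section convexity.
Variables (R : realType) (d : nat).
Implicit Types (B : set 'rV[R]_d) (f : 'rV[R]_d -> R).

(* The norm `|x| of the library is the sup norm. *)
Definition euclidean_norm (x : 'rV[R]_d) : R :=
  Num.sqrt (\sum_(j < d) x 0 j ^+ 2).

Definition centered_closed_ball (r : R) : set 'rV[R]_d :=
  [set x | euclidean_norm x <= r].

(* A function on B is represented by a function on the whole space, of which
   only the values on B are used. *)
Definition convex_cone B : set ('rV[R]_d -> R) :=
  [set f : 'rV[R]_d -> R | {within B, continuous f} /\ convex_function B f].

Definition strictly_convex B f : Prop :=
  forall x y (t : R), B x -> B y -> x != y -> 0 < t -> t < 1 ->
  f (t *: x + (1 - t) *: y) < t * f x + (1 - t) * f y.

(* C^1 up to the boundary: f is continuous on B, differentiable in the interior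
   of B, and its derivatives extend continuously to B. *)
Definition C1_on B f : Prop :=
  [/\ {within B, continuous f},
      forall x, B° x -> differentiable f x &
      forall v, exists g : 'rV[R]_d -> R, {within B, continuous g} /\
        forall x, B° x -> g x = 'D_v f x].

End convexity.

Section comonotonicity.
Variables (R : realType) (d p : nat).
Implicit Types (B : set 'rV[R]_d).
Implicit Types (gamma : probability 'M[R]_(p, d) R).
Implicit Types (psi w : 'I_p -> 'rV[R]_d -> R).

Definition sum_components (x : 'M[R]_(p, d)) : 'rV[R]_d := \sum_(i < p) row i x.

(* B^p *)
Definition ball_pow B : set 'M[R]_(p, d) := [set x | forall i, B (row i x)].

(* p B *)
Definition ball_dil B : set 'rV[R]_d := [set p%:R *: x | x in B].

Definition in_M (m0 : probability 'rV[R]_d R) gamma : Prop :=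
  compact (support_of gamma) /\
  forall A : set 'rV[R]_d, measurable A ->
    gamma (sum_components @^-1` A) = m0 A.

Definition in_MB B (m0 : probability 'rV[R]_d R) gamma : Prop :=
  in_M m0 gamma /\ gamma (ball_pow B) = 1%E.

Definition separable_cost psi (x : 'M[R]_(p, d)) : R :=
  \sum_(i < p) psi i (row i x).

Definition dominates B gamma pi : Prop :=
  forall phi : 'I_p -> 'rV[R]_d -> R, (forall i, convex_cone B (phi i)) ->
  \int[gamma]_(x in ball_pow B) separable_cost phi x <=
  \int[pi]_(x in ball_pow B) separable_cost phi x.

Definition strictly_dominates B gamma pi : Prop :=
  dominates B gamma pi /\
  forall phi : 'I_p -> 'rV[R]_d -> R,
  (forall i, convex_cone B (phi i) /\ strictly_convex B (phi i)) ->
  \int[gamma]_(x in ball_pow B) separable_cost phi x <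
  \int[pi]_(x in ball_pow B) separable_cost phi x.

Definition allocations B (x : 'rV[R]_d) : set 'M[R]_(p, d) :=
  [set y | ball_pow B y /\ sum_components y = x].

Definition minimizers B psi (x : 'rV[R]_d) : set 'M[R]_(p, d) :=
  [set y | allocations B x y /\
     forall z, allocations B x z -> separable_cost psi y <= separable_cost psi z].

(* For strictly convex psi and x in p B, minimizers B psi x is a singleton and
   optimal_map B psi x is its element (the junk value 0 is taken off p B). *)
Definition optimal_map B psi (x : 'rV[R]_d) : 'M[R]_(p, d) :=
  xget 0 (minimizers B psi x).

(* gamma = gamma_psi *)
Definition is_image_by_optimal_map B (m0 : probability 'rV[R]_d R) psi gamma : Prop :=
  forall f : 'M[R]_(p, d) -> R, {within ball_pow B, continuous f} ->
  \int[gamma]_(x in ball_pow B) f x =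
  \int[m0]_(x in ball_dil B) f (optimal_map B psi x).

Definition strictly_comonotone B (m0 : probability 'rV[R]_d R) w gamma : Prop :=
  in_MB B m0 gamma /\
  exists psi, (forall i, convex_cone B (psi i) /\
                 convex_cone B (fun x => psi i x - w i x)) /\
    is_image_by_optimal_map B m0 psi gamma.

Definition comonotone B (m0 : probability 'rV[R]_d R) w gamma : Prop :=
  in_MB B m0 gamma /\
  exists g : nat -> probability 'M[R]_(p, d) R,
    (forall n, strictly_comonotone B m0 w (g n)) /\
    forall f : 'M[R]_(p, d) -> R, {within ball_pow B, continuous f} ->
      (fun n => \int[g n]_(x in ball_pow B) f x) @ \oo -->
      \int[gamma]_(x in ball_pow B) f x.

End comonotonicity.

(* Main.v *)
(* For a family psi with psi_i - w_i convex, let c_psi be its separable cost, T_psi its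
   optimal map, and J(psi) the mean of c_psi(XX) - c_psi(T_psi(X)) >= 0, the excess of
   the given allocation over the optimal one.  Take a minimizing sequence psi_n of J.
   Since psi_i - w_i is convex, c_psi(z) - c_psi(T_psi) >= gap(z, T_psi) for feasible z,
   where gap is the midpoint convexity gap of the cost of w, which on a compact set
   controls the distance.  Testing J at the midpoint of two families shows that the maps
   T_psi_n are Cauchy in L^1, so a suitable sequence converges almost surely to a map T, and
   gamma is the law of T(X).
   Moving from psi_n towards an admissible chi gives
   inf J <= E c_chi(XX) - E c_chi(T(X)).  With chi = w + s phi and s -> oo this is
   domination, and with chi = w it is a strict inequality for w unless inf J = 0, in which
   case T_psi_n(X) tends to XX and gamma_0 is itself comonotone.  A strict inequality for w
   propagates to every strictly convex phi, because phi - e w is, up to o(e), convex. *)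
Require Import Defs.
From mathcomp Require Import all_boot all_order all_algebra.
From mathcomp Require Import all_classical all_reals all_analysis.
From mathcomp Require Import measurable_realfun ring lra.
Import Order.TTheory GRing.Theory Num.Theory.
Import numFieldNormedType.Exports.
Local Open Scope classical_set_scope.
Local Open Scope ring_scope.
Set Implicit Arguments.
Unset Strict Implicit.
Unset Printing Implicit Defensive.

(** * Continuity relative to a subset, and moduli on compact sets *)

Lemma within_comp {T U V : topologicalType} (A : set T) (D : set U)
    (F : T -> U) (f : U -> V) :
  {within A, continuous F} -> (forall x, A x -> D (F x)) ->
  {within D, continuous f} -> {within A, continuous (f \o F)}.
Proof.
move=> /subspace_continuousP cF AD /subspace_continuousP cf.
apply/subspace_continuousP => x Ax.
apply: (@cvg_comp _ _ _ F f _ (within D (nbhs (F x)))); last exact: cf (AD _ Ax).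
move=> W /= DW; have : within A (nbhs x) [set z | D (F z) -> W (F z)] by exact: cF x Ax _ DW.
rewrite /fmap /within /=.
by apply: filterS => z /= DFW Az; exact: DFW Az (AD _ Az).
Qed.

Section within_continuity.
Context {R : realType}.

Lemma within_continuousZ {T : topologicalType} (A : set T) (a : R) (f : T -> R) :
  {within A, continuous f} -> {within A, continuous (fun x => a * f x)}.
Proof. by move=> cf x; apply: cvgMr; exact: cf. Qed.

Lemma within_continuous_norm {T : topologicalType} (A : set T) (f : T -> R) :
  {within A, continuous f} -> {within A, continuous (fun x => `|f x|)}.
Proof. by move=> cf x; apply: cvg_norm; exact: cf. Qed.

Lemma within_continuous_max {T : topologicalType} (A : set T) (f g : T -> R) :
  {within A, continuous f} -> {within A, continuous g} ->
  {within A, continuous (fun x => Num.max (f x) (g x))}.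
Proof.
by move=> cf cg x; apply: (@continuous_max R (subspace A)); [exact: cf|exact: cg].
Qed.

Lemma within_continuous_sum {T : topologicalType} (A : set T) (I : finType)
    (f : I -> T -> R) :
  (forall i, {within A, continuous (f i)}) ->
  {within A, continuous (fun x => \sum_i f i x)}.
Proof.
move=> cf; pose P (g : T -> R) := {within A, continuous g}.
have -> : (fun x => \sum_i f i x) = \sum_i f i.
  by apply/funext => x; rewrite fct_sumE.
apply: (big_ind P) => [|g h|i _]; [|exact: within_continuousD|exact: cf].
by apply: continuous_subspaceT => x; exact: cvg_cst.
Qed.

Lemma within_continuous_fst {T U : topologicalType} (A : set T) (A' : set U)
    (f : T -> R) :
  {within A, continuous f} -> {within A `*` A', continuous (fun z => f z.1)}.
Proof.
move=> cf; apply: (within_comp _ _ cf); last by move=> [? ?] [].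
by apply: continuous_subspaceT => x; exact: cvg_fst.
Qed.

Lemma within_continuous_snd {T U : topologicalType} (A : set T) (A' : set U)
    (f : U -> R) :
  {within A', continuous f} -> {within A `*` A', continuous (fun z => f z.2)}.
Proof.
move=> cf; apply: (within_comp _ _ cf); last by move=> [? ?] [].
by apply: continuous_subspaceT => x; exact: cvg_snd.
Qed.

Lemma compact_within_preimage {T : topologicalType} (A : set T) (f : T -> R)
    (F : set R) :
  {within A, continuous f} -> closed F -> compact A -> compact (A `&` f @^-1` F).
Proof.
move=> cf cF cA.
have /closed_subspaceP[V cV VE] : closed (f @^-1` F : set (subspace A)).
  by move/continuous_closedP : cf; exact.
by rewrite setIC -VE setIC; exact: compact_closedI.
Qed.

(* On the complement of a neighbourhood [h < delta] of the diagonal, the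
   function [g] is bounded below by a positive constant. *)
Lemma diagonal_modulus {T : topologicalType} (K : set T) (g h : T * T -> R)
    (delta : R) :
  compact K -> {within K `*` K, continuous g} -> {within K `*` K, continuous h} ->
  (forall x y, K x -> K y -> 0 <= g (x, y)) ->
  (forall x y, K x -> K y -> g (x, y) = 0 -> x = y) ->
  (forall x, K x -> h (x, x) = 0) -> 0 < delta ->
  exists2 C, 0 < C &
    forall x y, K x -> K y -> h (x, y) <= delta + C * g (x, y).
Proof.
move=> cK cg ch g0 gd hd dl.
have cKK : compact (K `*` K) by exact: compact_setX.
pose N := (K `*` K) `&` h @^-1` [set t | delta <= t].
have cN : compact N.
  by apply: compact_within_preimage => //; exact: closed_ge.
have NK : N `<=` K `*` K by move=> ? [].
(* If [N] is empty then [h] stays below [delta] on all of [K * K], and any positive constant will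
   do. *)
have [[z Nz]|N0] := pselect (N !=set0); last first.
  exists 1 => // x y Kx Ky; rewrite mul1r.
  have [hd'|hd'] := leP (h (x, y)) delta; first by rewrite ler_wpDr// g0.
  by exfalso; apply: N0; exists (x, y); split => //=; exact: ltW.
have N0 : N !=set0 by exists z.
have cgN : {within N, continuous g} := continuous_subspaceW NK cg.
have chN : {within N, continuous h} := continuous_subspaceW NK ch.
have [[u1 u2] /set_mem [[/= Ku1 Ku2] hu] umin] := compact_EVT_min N0 cN cgN.
have [[v1 v2] /set_mem [[/= Kv1 Kv2] hv] vmax] := compact_EVT_max N0 cN chN.
have gu : 0 < g (u1, u2).
  rewrite lt_neqAle g0// andbT; apply/eqP => /esym /gd u12.
  by move: hu; rewrite (u12 Ku1 Ku2) hd//= leNgt dl.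
have hv0 : 0 < h (v1, v2) by exact: lt_le_trans hv.
(* Maximum of [h] over minimum of [g] on the compact set [N]; that minimum is positive because [g]
   vanishes only on the diagonal, where [h = 0 < delta]. *)
exists (h (v1, v2) / g (u1, u2)); first by rewrite divr_gt0.
move=> x y Kx Ky.
have [hd'|hd'] := leP (h (x, y)) delta.
  by rewrite ler_wpDr// mulr_ge0 ?g0// divr_ge0// ltW.
have Nxy : N (x, y) by split => //=; exact: ltW.
rewrite ler_wpDl ?(ltW dl)//.
rewrite (le_trans (vmax _ (mem_set Nxy)))//.
rewrite -mulrA ler_pMr// ler_pdivlMl// mulr1.
exact: umin (mem_set Nxy).
Qed.

End within_continuity.

(** * The Borel sigma-algebra on matrices *)

Section borel_matrices.
Context {R : realType}.

Lemma open_measurable_mx m n (U : set 'M[R]_(m, n)) : open U -> measurable U.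
Proof. by move=> oU; exact: sub_sigma_algebra. Qed.

Lemma closed_measurable_mx m n (U : set 'M[R]_(m, n)) : closed U -> measurable U.
Proof.
move=> cU; rewrite -(setCK U); apply: measurableC.
by apply: open_measurable_mx; exact: closed_openC.
Qed.

Lemma compact_measurable_mx m n (U : set 'M[R]_(m, n)) : compact U -> measurable U.
Proof.
by move=> cU; apply: closed_measurable_mx; exact: compact_closed.
Qed.

Lemma measurable_fun_closed_mx d (T : measurableType d) m n (f : T -> 'M[R]_(m, n)) :
  (forall F, closed F -> measurable (f @^-1` F)) -> measurable_fun setT f.
Proof.
move=> mf; apply: (measurability (@open 'M[R]_(m, n))) => //.
move=> _ [U oU <-]; rewrite setTI -(setCK U) preimage_setC.
by apply: measurableC; exact: (mf _ (open_closedC oU)).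
Qed.

Lemma continuous_measurable_mx m n m' n' (f : 'M[R]_(m, n) -> 'M[R]_(m', n')) :
  continuous f -> measurable_fun setT f.
Proof.
move=> cf; apply: measurable_fun_closed_mx => F cF.
by apply: closed_measurable_mx; move/continuous_closedP : cf; exact.
Qed.

Lemma within_continuous_measurable_mx m n (D : set 'M[R]_(m, n))
    (f : 'M[R]_(m, n) -> R) :
  measurable D -> {within D, continuous f} -> measurable_fun D f.
Proof.
move=> mD cf; apply: (measurability _ (@RGenOInfty.measurableE R)) => //.
move=> _ [U [a ->] <-].
have /open_subspaceP[V oV VE] : open (f @^-1` `]a, +oo[ : set (subspace D)).
  by move/continuousP : cf; apply; exact: interval_open.
by rewrite setIC -VE; apply: measurableI => //; exact: open_measurable_mx.
Qed.

Lemma measurable_coord_mx m n i j :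
  measurable_fun setT (fun x : 'M[R]_(m, n) => x i j).
Proof.
apply: within_continuous_measurable_mx => //.
by apply: continuous_subspaceT; exact: coord_continuous.
Qed.

(** An open set is the countable union of the balls it contains that have rational centre and radius
    [1 / (k + 1)]. A ball of the sup norm is a product of intervals, so its preimage is a finite
    intersection of preimages under the coordinates. *)
Lemma measurable_fun_coord_mx d (T : measurableType d) m n (f : T -> 'M[R]_(m, n)) :
  (forall i j, measurable_fun setT (fun t => f t i j)) -> measurable_fun setT f.
Proof.
move=> mf; apply: (measurability (@open 'M[R]_(m, n))) => //.
move=> _ [U oU <-]; rewrite setTI.
pose e (k : nat) : R := k.+1%:R^-1.
pose q_ (q : 'M[rat]_(m, n)) : 'M[R]_(m, n) := \matrix_(i, j) ratr (q i j).
pose Q (qk : 'M[rat]_(m, n) * nat) : set 'M[R]_(m, n) :=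
  [set x | ball (q_ qk.1) (e qk.2) `<=` U /\ ball (q_ qk.1) (e qk.2) x].
have e0 k : 0 < e k by rewrite /e invr_gt0.
have -> : U = \bigcup_qk Q qk.
  apply/seteqP; split => [x Ux|x [[q k] _ [qU]]]; last exact: qU.
  have /nbhs_ballP[r r0 rU] : nbhs x U by exact: open_nbhs_nbhs.
  have [k kr] : exists k, e k < r / 2.
    have [k _ kP] := near_infty_natSinv_lt (PosNum (divr_gt0 r0 (ltr0Sn R 1))).
    by exists k; exact: kP (leqnn k).
  have qP i j : exists q : rat, `|ratr q - x i j| < e k.
    have [|q] := @rat_in_itvoo R (x i j) (x i j + e k); first by rewrite ltrDl.
    rewrite in_itv/= => /andP[q1 q2].
    by exists q; rewrite ger0_norm ?subr_ge0 1?ltW// ltrBlDl.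
  pose q := \matrix_(i, j) sval (cid (qP i j)).
  have qx i j : `|q_ q i j - x i j| < e k.
    by rewrite /q_ /q !mxE; case: cid.
  exists (q, k) => //; split; last by split => // i j; exact: qx.
  move=> y [_ qy]; apply: rU; split => // i j.
  rewrite /ball /= (le_lt_trans (ler_distD (q_ q i j) _ _))//.
  by have := qx i j; have := qy i j; rewrite /ball /= distrC (splitr r); lra.
rewrite preimage_bigcup; apply: countable_bigcupT_measurable => [|qk].
  exact: countableP.
have [qU|nqU] := pselect (ball (q_ qk.1) (e qk.2) `<=` U); last first.
  by rewrite (_ : f @^-1` _ = set0)//; apply/seteqP; split => // t [].
have -> : f @^-1` Q qk =
    \big[setI/setT]_(ij : 'I_m * 'I_n)
      ((fun t => f t ij.1 ij.2) @^-1` (ball (q_ qk.1 ij.1 ij.2) (e qk.2))).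
  apply/seteqP; split => [t [_ [_ tb]]|t].
    by rewrite -bigcap_seq => -[i j] _ /=; exact: tb.
  rewrite -bigcap_seq => tb; split => //; split => // i j.
  by apply: (tb (i, j)); rewrite /= mem_index_enum.
apply: bigsetI_measurable => -[i j] _ /=.
rewrite -[X in measurable X]setTI; apply: mf => //.
by apply: open_measurable; exact: ball_open.
Qed.

End borel_matrices.

(** * Entrywise convergence of matrices *)

Section matrix_continuity.
Context {R : realType}.

Lemma cvg_mx {T : Type} (G : set_system T) {FG : Filter G} m n
    (f : T -> 'M[R]_(m, n)) (l : 'M[R]_(m, n)) :
  (forall i j, f t i j @[t --> G] --> l i j) -> f t @[t --> G] --> l.
Proof.
move=> fl; apply/cvgrPdist_lt => e e0.
have : \forall t \near G, forall i, forall j, `|l i j - f t i j| < e.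
  apply: filter_forall => i; apply: filter_forall => j.
  by move/cvgrPdist_lt : (fl i j); exact.
apply: filterS => t te.
have : ball l e (f t) by split => // i j; exact: te.
by rewrite mx_norm_ball.
Qed.

Lemma continuous_mx {T : topologicalType} m n (f : T -> 'M[R]_(m, n)) :
  (forall i j, continuous (fun t => f t i j)) -> continuous f.
Proof. by move=> cf t; apply: cvg_mx => i j; exact: cf. Qed.

Lemma cvg_coord_mx {T : Type} (G : set_system T) {FG : Filter G} m n
    (f : T -> 'M[R]_(m, n)) (l : 'M[R]_(m, n)) i j :
  f t @[t --> G] --> l -> f t i j @[t --> G] --> l i j.
Proof.
move=> fl.
exact: (@cvg_comp _ _ _ f (fun x : 'M[R]_(m, n) => x i j) _ _ _ fl
          (@coord_continuous _ _ _ i j l)).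
Qed.

End matrix_continuity.

(** * Integrals over a compact set of full measure *)

Section bounded_integrals.
Context {R : realType} {m n : nat}.
Notation M := 'M[R]_(m, n).
Context (g0 : probability M R) (D : set M).
Hypotheses (cD : compact D) (g0D : g0 D = 1%E).
Implicit Types (F : M -> M) (h : M -> R).

(** Integrands are compositions [f \o F] with [f] continuous on [D] only, so [F] must not leave [D];
    measurability is asked globally so that laws of such maps can be formed. *)
Definition self_map F := measurable_fun setT F /\ forall y, D y -> D (F y).

Let mD : measurable D. Proof. exact: compact_measurable_mx. Qed.

Let g0D_fin : (g0 D < +oo)%E. Proof. by rewrite g0D ltry. Qed.

Definition Dintegrable h := g0.-integrable D (EFin \o h).

Lemma self_map_id : self_map id.
Proof. by split => //; exact: measurable_id. Qed.

Lemma within_continuous_bounded {T : topologicalType} (A : set T) (f : T -> R) :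
  compact A -> {within A, continuous f} -> exists C, forall y, A y -> `|f y| <= C.
Proof.
move=> cA cf; have [A0|nA] := pselect (A !=set0); last first.
  by exists 0 => y Ay; exfalso; apply: nA; exists y.
have [c _ cmax] := compact_EVT_max A0 cA (within_continuous_norm cf).
by exists `|f c| => y Ay; exact: cmax (mem_set Ay).
Qed.

Lemma Dintegrable_bounded h C : measurable_fun D h ->
  (forall y, D y -> `|h y| <= C) -> Dintegrable h.
Proof.
move=> mh hC; apply: measurable_bounded_integrable => //.
exists C; split; first exact: num_real.
by move=> x Cx y Dy; apply: le_trans (hC y Dy) _; exact: ltW.
Qed.

Lemma measurable_fun_col_mx F1 F2 :
  measurable_fun setT F1 -> measurable_fun setT F2 ->
  measurable_fun setT (fun y => col_mx (F1 y) (F2 y)).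
Proof.
move=> m1 m2; apply: measurable_fun_coord_mx => i j.
case: (fintype.splitP i) => k ik.
- rewrite (_ : (fun _ => _) = (fun y => F1 y k j)); last first.
    by apply/funext => y; rewrite (_ : i = lshift m k) ?col_mxEu//; exact: val_inj.
  by apply: (measurableT_comp (measurable_coord_mx k j)).
- rewrite (_ : (fun _ => _) = (fun y => F2 y k j)); last first.
    by apply/funext => y; rewrite (_ : i = rshift m k) ?col_mxEd//; exact: val_inj.
  by apply: (measurableT_comp (measurable_coord_mx k j)).
Qed.

(* Pairs are encoded as stacked matrices: the product sigma-algebra on [M * M] is
   not known to contain the Borel sets, so [h] cannot be composed directly. *)
Lemma Dintegrable_pair (h : M * M -> R) F1 F2 :
  {within D `*` D, continuous h} -> self_map F1 -> self_map F2 ->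
  Dintegrable (fun y => h (F1 y, F2 y)).
Proof.
move=> ch [m1 D1] [m2 D2].
have [C hC] := within_continuous_bounded (compact_setX cD cD) ch.
apply: (@Dintegrable_bounded _ C) => [|y Dy]; last by apply: hC; split; [exact: D1|exact: D2].
pose u (x : 'M[R]_(m + m, n)) : M * M := (usubmx x, dsubmx x).
have c1 : continuous (@usubmx R m m n).
  apply: continuous_mx => i j x.
  by under eq_fun do rewrite mxE; exact: coord_continuous.
have c2 : continuous (@dsubmx R m m n).
  apply: continuous_mx => i j x.
  by under eq_fun do rewrite mxE; exact: coord_continuous.
have cu : continuous u by move=> x; exact: (cvg_pair (c1 x) (c2 x)).
pose D' := u @^-1` (D `*` D).
have mD' : measurable D'.
  have -> : D' = @usubmx R m m n @^-1` D `&` @dsubmx R m m n @^-1` D by [].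
  have clD : closed D by exact: compact_closed.
  by apply: closed_measurable_mx; apply: closedI; [move/continuous_closedP : c1|
    move/continuous_closedP : c2]; exact.
have mh : measurable_fun D' (h \o u).
  apply: within_continuous_measurable_mx => //.
  apply: (within_comp (D := D `*` D)) ch => //.
  exact: continuous_subspaceT.
rewrite (_ : (fun _ => _) = (h \o u) \o (fun y => col_mx (F1 y) (F2 y))); last first.
  by apply/funext => y; rewrite /u /= col_mxKu col_mxKd.
apply: (measurable_comp mD') mh _.
  by move=> _ [y Dy <-]; rewrite /D' /u /= col_mxKu col_mxKd; split; [exact: D1|exact: D2].
by apply: (measurable_funS measurableT) => //; exact: measurable_fun_col_mx.
Qed.

Lemma Dintegrable_comp h F :
  {within D, continuous h} -> self_map F -> Dintegrable (h \o F).
Proof.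
move=> ch [mF DF].
have [C hC] := within_continuous_bounded cD ch.
apply: (@Dintegrable_bounded _ C) => [|y Dy]; last exact/hC/DF.
apply: (measurable_comp mD); first by move=> _ [y Dy <-]; exact: DF.
  exact: within_continuous_measurable_mx.
exact: (measurable_funS measurableT).
Qed.

Lemma DintegrableD h1 h2 : Dintegrable h1 -> Dintegrable h2 ->
  Dintegrable (fun y => h1 y + h2 y).
Proof. by move=> i1 i2; exact: (integrableD mD i1 i2). Qed.

Lemma DintegrableB h1 h2 : Dintegrable h1 -> Dintegrable h2 ->
  Dintegrable (fun y => h1 y - h2 y).
Proof. by move=> i1 i2; exact: (integrableB mD i1 i2). Qed.

Lemma DintegrableZ a h : Dintegrable h -> Dintegrable (fun y => a * h y).
Proof. by move=> i1; exact: (integrableZl mD a i1). Qed.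

Lemma Dintegrable_cst a : Dintegrable (fun=> a).
Proof. by apply: (@Dintegrable_bounded _ `|a|). Qed.

Notation E h := (\int[g0]_(y in D) h y).

Lemma Dint_cst a : E (fun=> a) = a.
Proof.
rewrite Rintegral_cst//; have -> : fine (g0 D) = 1 by rewrite g0D.
by rewrite mulr1.
Qed.

Lemma DintD h1 h2 : Dintegrable h1 -> Dintegrable h2 ->
  E (fun y => h1 y + h2 y) = E h1 + E h2.
Proof. by move=> i1 i2; rewrite RintegralD. Qed.

Lemma DintB h1 h2 : Dintegrable h1 -> Dintegrable h2 ->
  E (fun y => h1 y - h2 y) = E h1 - E h2.
Proof. by move=> i1 i2; rewrite RintegralB. Qed.

Lemma DintZ a h : Dintegrable h -> E (fun y => a * h y) = a * E h.
Proof. by move=> i1; rewrite RintegralZl. Qed.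

Lemma Dint_le h1 h2 : Dintegrable h1 -> Dintegrable h2 ->
  (forall y, D y -> h1 y <= h2 y) -> E h1 <= E h2.
Proof. by move=> i1 i2 h12; exact: le_Rintegral. Qed.

Lemma Dint_eq h1 h2 : (forall y, D y -> h1 y = h2 y) -> E h1 = E h2.
Proof. by move=> h12; apply: eq_Rintegral => y /set_mem; exact: h12. Qed.

End bounded_integrals.

(** * Almost sure limits of maps that are Cauchy in mean *)

Lemma ler_coord_mx_norm {R : realType} m n (x : 'M[R]_(m, n)) i j :
  `|x i j| <= `|x|.
Proof.
by rewrite [leRHS]/Num.norm /= mx_normrE; apply/bigmax_geP; right; exists (i, j).
Qed.

Section almost_sure_limits.
Context {R : realType} {m n : nat}.
Notation M := 'M[R]_(m, n).
Context (g0 : probability M R) (D : set M).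
Hypotheses (cD : compact D) (g0D : g0 D = 1%E).
Notation E h := (\int[g0]_(y in D) h y).

Let mD : measurable D. Proof. exact: compact_measurable_mx. Qed.

Let g0D_fin : (g0 D < +oo)%E. Proof. by rewrite g0D ltry. Qed.

Lemma normr_sub_within : {within D `*` D, continuous (fun z : M * M => `|z.1 - z.2|)}.
Proof.
apply: continuous_subspaceT => z; apply: cvg_norm.
by apply: cvgB; [exact: cvg_fst|exact: cvg_snd].
Qed.

(** The sum of the increments has mean at most [1], hence is finite outside a null set [N]. On
    [G = D \ N] each entry of [F k y] is the partial sum of an absolutely convergent series. *)
Lemma summable_increments_cvg (F : nat -> M -> M) :
  (forall k, self_map D (F k)) ->
  (forall k, E (fun y => `|F k.+1 y - F k y|) <= 1 / (2 ^ k.+1)%:R) ->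
  exists T G, [/\ self_map D T, measurable G, G `<=` D, g0 G = 1%E &
    forall y, G y -> F k y @[k --> \oo] --> T y].
Proof.
move=> sF Fle; pose u k y := `|F k.+1 y - F k y|.
have iu k : Dintegrable g0 D (u k).
  exact: (Dintegrable_pair cD g0D normr_sub_within (sF k.+1) (sF k)).
have mu k : measurable_fun D (EFin \o u k).
  exact: measurable_int (iu k).
pose s y := (\sum_(0 <= k <oo) (u k y)%:E)%E.
have ms : measurable_fun D s.
  apply: (@ge0_emeasurable_sum _ _ R D (fun k y => (u k y)%:E) xpredT) => [k y _ _|k _].
    by rewrite lee_fin normr_ge0.
  exact: mu.
have is1 : g0.-integrable D s.
  apply/integrableP; split => //.
  under eq_integral => y _.
    rewrite gee0_abs; last by apply: nneseries_ge0 => k _ _; rewrite lee_fin normr_ge0.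
    over.
  rewrite integral_nneseries//; last by move=> k y _; rewrite lee_fin normr_ge0.
  apply: (@le_lt_trans _ _ 1%E); last by rewrite ltry.
  apply: le_trans (@epsilon_trick0 R 1 xpredT ler01).
  apply: lee_nneseries => [k _ _|k _].
    by apply: integral_ge0 => y _; rewrite lee_fin normr_ge0.
  rewrite -[leLHS]fineK; last exact: integrable_fin_num (iu k).
  by rewrite lee_fin; exact: Fle.
have [N [mN N0 sN]] := integrable_ae mD is1.
pose G := D `\` N.
have mG : measurable G by exact: measurableD.
have g0G : g0 G = 1%E.
  have DN : g0 (D `&` N) = 0%E.
    by apply: (subset_measure0 _ mN) => //; exact: measurableI.
  transitivity (g0 D - g0 (D `&` N))%E; last by rewrite DN g0D sube0.
  exact: measureD mD mN g0D_fin.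
have cF y i j : G y -> cvgn (fun k => F k y i j).
  move=> [Dy Ny].
  have sy : s y \is a fin_num by apply: contra_notP Ny => h; apply: sN => /(_ Dy).
  have cs : cvgn (series (fun k => u k y)).
    apply: nondecreasing_is_cvgn.
      by apply/nondecreasing_seqP => k; rewrite seriesEnat /= big_nat_recr//= lerDl /u.
    exists (fine (s y)) => _ [k _ <-].
    rewrite -lee_fin fineK// -sumEFin.
    by apply: nneseries_lim_ge => l _ _; rewrite lee_fin normr_ge0.
  pose v k := F k.+1 y i j - F k y i j.
  have cv : cvgn (series v).
    apply: normed_cvg; apply: series_le_cvg cs => // k; rewrite /u ?normr_ge0//.
    by have := ler_coord_mx_norm (F k.+1 y - F k y) i j; rewrite !mxE.
  have -> : (fun k => F k y i j) = (fun k => F 0 y i j + series v k).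
    by apply/funext => k; exact: (eq_sum_telescope (fun k => F k y i j)).
  by apply: is_cvgD => //; exact: is_cvg_cst.
(* Off [G] the sequence is replaced by the constant [y]. It then converges everywhere, its limit is
   measurable on the whole space, and the limit of a point of [D] stays in the closed set [D]. *)
pose H k y := if y \in G then F k y else y.
have mH k : measurable_fun setT (H k).
  apply: measurable_fun_closed_mx => C cC.
  have -> : H k @^-1` C = (G `&` F k @^-1` C) `|` (~` G `&` C).
    apply/seteqP; split => [y|y]; rewrite /H /=.
      by case: ifPn => [/set_mem Gy|/negP nGy] Cy; [left|right; split => // /mem_set].
    by case=> -[Gy Cy]; [rewrite mem_set|rewrite memNset].
  apply: measurableU; apply: measurableI => //.
  - by rewrite -[X in measurable X]setTI; apply: (sF k).1 => //; exact: closed_measurable_mx.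
  - exact: measurableC.
  - exact: closed_measurable_mx.
pose T y : M := \matrix_(i, j) limn (fun k => H k y i j).
have HT y : H k y @[k --> \oo] --> T y.
  apply: cvg_mx => i j; rewrite mxE.
  rewrite /H; have [Gy|nGy] := pselect (G y).
    by rewrite (mem_set Gy); exact: cF.
  by rewrite (memNset nGy); exact: is_cvg_cst.
have FT y : G y -> F k y @[k --> \oo] --> T y.
  by move=> Gy; have := HT y; rewrite /H mem_set.
exists T, G; split => //; last by move=> y [].
split=> [|y Dy].
  apply: measurable_fun_coord_mx => i j.
  apply: (measurable_fun_cvg (h := fun k y => H k y i j)) => [k|y _].
    by apply: (measurableT_comp (measurable_coord_mx i j)).
  by apply: cvg_coord_mx; exact: HT.
have clD : closed D by exact: compact_closed.
apply: (closed_cvg D clD _ _ (HT y)).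
by apply: nearW => k; rewrite /H; case: ifPn => // _; exact: (sF k).2.
Qed.

(** Dominated convergence, with the bound of [f] on the compact set [D] as dominating constant.
    Continuity of [f] within [D] suffices because the sequence and its limit both lie in [D]. *)
Lemma cvg_Dint_comp (f : M -> R) (F : nat -> M -> M) T G :
  (forall k, self_map D (F k)) -> self_map D T ->
  measurable G -> G `<=` D -> g0 G = 1%E ->
  (forall y, G y -> F k y @[k --> \oo] --> T y) ->
  {within D, continuous f} ->
  E (fun y => f (F k y)) @[k --> \oo] --> E (fun y => f (T y)).
Proof.
move=> sF sT mG GD g0G FT cf.
have [C hC] := within_continuous_bounded cD cf.
have iF F' : self_map D F' -> g0.-integrable D (EFin \o (f \o F')).
  by move=> sF'; exact: (Dintegrable_comp cD g0D).
have mF F' : self_map D F' -> measurable_fun D (EFin \o (f \o F')).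
  by move=> sF1; exact: measurable_int (iF _ sF1).
have aeG (Q : M -> Prop) : (forall y, G y -> Q y) -> {ae g0, forall y, D y -> Q y}.
  move=> GQ; exists (D `\` G); split; first exact: measurableD.
    transitivity (g0 D - g0 (D `&` G))%E.
      exact: measureD mD mG g0D_fin.
    by rewrite setIidr// g0D g0G subee.
  by move=> y /= /not_implyP[Dy nQ]; split => // /GQ.
have iT := iF _ sT.
have aecvg : {ae g0, forall y, D y ->
    (fun k => (f (F k y))%:E) @ \oo --> (f (T y))%:E}.
  apply: aeG => y Gy; apply: cvg_EFin; first exact: nearW.
  have /subspace_continuousP cf' := cf.
  have DTy : D (T y) by apply: sT.2; exact: GD.
  apply: (@cvg_comp _ _ _ (F ^~ y) f _ (within D (nbhs (T y)))); last exact: cf'.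
  move=> W DW.
  have : \forall k \near \oo, D (F k y) -> W (F k y) by exact: FT y Gy _ DW.
  by apply: filterS => k DWk; apply: DWk; apply: (sF k).2; exact: GD.
have aele : {ae g0, forall y k, D y -> (`|(f (F k y))%:E| <= C%:E)%E}.
  by apply: aeW => y k Dy; rewrite lee_fin hC//; exact: (sF k).2.
have iC : g0.-integrable D (cst C%:E) by exact: (Dintegrable_cst cD g0D C).
have [_ _] := dominated_convergence mD (fun k => mF _ (sF k)) (mF _ sT) aecvg iC aele.
move=> lim; apply/fine_cvg; rewrite fineK//; last exact: integrable_fin_num iT.
Qed.

End almost_sure_limits.

(** * Minimizing sequences for the excess, over an abstract class [K] of costs with minimizers
    [F] *)

Section minimizing_sequences.
Context {R : realType} {m n : nat} {V : Type}.
Notation M := 'M[R]_(m, n).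
Context (g0 : probability M R) (D : set M) (S : M -> V) (gap : M * M -> R).
Context (K : set (M -> R)) (F : (M -> R) -> M -> M) (w : M -> R).
Hypotheses (cD : compact D) (g0D : g0 D = 1%E).
Hypotheses (cgap : {within D `*` D, continuous gap})
  (gap0 : forall x y, D x -> D y -> 0 <= gap (x, y))
  (gapd : forall x y, D x -> D y -> gap (x, y) = 0 -> x = y).
Hypotheses (Kw : K w)
  (Kconv : forall c1 c2 t, K c1 -> K c2 -> 0 < t -> t < 1 ->
     K (fun y => (1 - t) * c1 y + t * c2 y))
  (Kcont : forall c, K c -> {within D, continuous c}).
Hypotheses (KF : forall c, K c -> self_map D (F c))
  (FS : forall c y, K c -> D y -> S (F c y) = S y)
  (Fmin : forall c y z, K c -> D y -> D z -> S z = S y ->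
     c (F c y) + gap (z, F c y) <= c z)
  (Sclosed : forall y, closed [set z | S z = S y]).

Notation E h := (\int[g0]_(y in D) h y).
Notation Dint := (Dintegrable g0 D).

(** The functional [J] of the overview, with [g0] as the law of the given allocation: [y] is the
    allocation, [S y] its total, and [F c y] the optimal allocation of that total. *)
Definition excess c := E (fun y => c y - c (F c y)).

Definition min_excess := inf (excess @` K).

Let mD : measurable D. Proof. exact: compact_measurable_mx. Qed.

Let iK c : K c -> Dint c.
Proof. by move=> Kc; exact: (Dintegrable_comp cD g0D (Kcont Kc) (self_map_id D)). Qed.

Let iKF c c' : K c -> K c' -> Dint (fun y => c (F c' y)).
Proof. by move=> Kc Kc'; exact: (Dintegrable_comp cD g0D (Kcont Kc) (KF Kc')). Qed.

Let DF c y : K c -> D y -> D (F c y).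
Proof. by move=> Kc; exact: (KF Kc).2. Qed.

Lemma excess_ge0 c : K c -> 0 <= excess c.
Proof.
move=> Kc; apply: Rintegral_ge0 => y Dy; rewrite subr_ge0.
by rewrite (le_trans _ (Fmin Kc Dy Dy erefl))// lerDl gap0//; exact: DF.
Qed.

Let lbK : has_inf (excess @` K).
Proof.
split; first by exists (excess w), w.
by exists 0 => _ [c Kc <-]; exact: excess_ge0.
Qed.

Lemma min_excess_ge0 : 0 <= min_excess.
Proof.
by apply: lb_le_inf; [exact: lbK.1|move=> _ [c Kc <-]; exact: excess_ge0].
Qed.

Lemma min_excess_le c : K c -> min_excess <= excess c.
Proof. by move=> Kc; apply: ge_inf; [exact: lbK.2|exists c]. Qed.

Lemma min_excess_adherent e : 0 < e -> exists2 c, K c & excess c <= min_excess + e.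
Proof.
move=> e0; have [_ [c Kc <-] ce] := inf_adherent e0 lbK.
by exists c => //; exact: ltW.
Qed.

(** [F c' y] has the same total as [y], so it competes with [F c y]. *)
Let Kle c c' : K c -> K c' -> forall y, D y ->
  c (F c y) + gap (F c' y, F c y) <= c (F c' y).
Proof. by move=> Kc Kc' y Dy; apply: Fmin => //; [exact: DF|exact: FS]. Qed.

Let igap c c' : K c -> K c' -> Dint (fun y => gap (F c y, F c' y)).
Proof. by move=> Kc Kc'; apply: Dintegrable_pair => //; exact: KF. Qed.

(* The minimizers for [c1] and [c2] are both close to the one for the midpoint
   cost, whose excess is at least [min_excess]. *)
Lemma gap_midpoint c1 c2 : K c1 -> K c2 ->
  exists2 c, K c &
    E (fun y => gap (F c y, F c1 y)) + E (fun y => gap (F c y, F c2 y)) <=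
    excess c1 + excess c2 - 2 * min_excess.
Proof.
move=> K1 K2; pose c y := (1 - 2^-1) * c1 y + 2^-1 * c2 y.
have Kc : K c by apply: Kconv => //; rewrite ?invr_gt0// invf_lt1// ltr1n.
exists c => //; have := min_excess_le Kc.
have -> : excess c = 2^-1 * E (fun y => c1 y - c1 (F c y)) +
                     2^-1 * E (fun y => c2 y - c2 (F c y)).
  rewrite -!(DintZ cD)//; try by apply: (DintegrableB cD); [exact: iK|exact: iKF].
  rewrite -(DintD cD); try by apply: (DintegrableZ cD); apply: (DintegrableB cD);
    [exact: iK|exact: iKF].
  by apply: Dint_eq => y _; rewrite /c; lra.
have gle c' : K c' -> E (fun y => c' y - c' (F c y)) <=
    excess c' - E (fun y => gap (F c y, F c' y)).
  move=> Kc'; rewrite -(DintB cD) //; last 2 first.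
  - by apply: (DintegrableB cD); [exact: iK|exact: iKF].
  - exact: igap.
  apply: (Dint_le cD).
  - by apply: (DintegrableB cD); [exact: iK|exact: iKF].
  - apply: (DintegrableB cD); last exact: igap.
    by apply: (DintegrableB cD); [exact: iK|exact: iKF].
  - by move=> y Dy; have := Kle Kc' Kc Dy; lra.
by have := gle _ K1; have := gle _ K2; lra.
Qed.

(** The hypothesis on [h] is a triangle inequality through a third point, here the minimizer for the
    cost given by [gap_midpoint]. The two mean gaps to that point are small, and [diagonal_modulus]
    turns a small gap into a small [h]. *)
Lemma near_minimizers_close (h : M * M -> R) eta :
  {within D `*` D, continuous h} -> (forall x, D x -> h (x, x) = 0) ->
  (forall x y z, D x -> D y -> D z -> h (x, y) <= h (z, x) + h (z, y)) ->
  0 < eta ->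
  exists2 e, 0 < e & forall c1 c2, K c1 -> K c2 ->
    excess c1 <= min_excess + e -> excess c2 <= min_excess + e ->
    E (fun y => h (F c1 y, F c2 y)) <= eta.
Proof.
move=> ch hd ht eta0.
have d0 : 0 < eta / 4 by rewrite divr_gt0.
have [C C0 hC] := diagonal_modulus cD cgap ch gap0 gapd hd d0.
(* The two mean gaps add up to at most [2 * e], so the bound is
   [2 * (eta / 4) + C * (2 * e) = eta]. *)
exists (eta / 4 / C) => [|c1 c2 K1 K2 e1 e2]; first by rewrite !divr_gt0.
have [c Kc cgp] := gap_midpoint K1 K2.
have ih c' c'' : K c' -> K c'' -> Dint (fun y => h (F c' y, F c'' y)).
  by move=> ? ?; apply: Dintegrable_pair => //; exact: KF.
have hle c' : K c' -> E (fun y => h (F c y, F c' y)) <=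
    eta / 4 + C * E (fun y => gap (F c y, F c' y)).
  move=> Kc'; rewrite -(DintZ cD); last exact: igap.
  rewrite -{1}(Dint_cst cD g0D (eta / 4)) -(DintD cD); last 2 first.
  - exact: (Dintegrable_cst cD g0D).
  - by apply: (DintegrableZ cD); exact: igap.
  apply: (Dint_le cD) => [||y Dy]; first exact: ih.
  - apply: (DintegrableD cD); first exact: (Dintegrable_cst cD g0D).
    by apply: (DintegrableZ cD); exact: igap.
  - by apply: hC; exact: DF.
apply: (@le_trans _ _ (E (fun y => h (F c y, F c1 y) + h (F c y, F c2 y)))).
  apply: (Dint_le cD) => [||y Dy]; first exact: ih.
  - by apply: (DintegrableD cD); exact: ih.
  - by apply: ht; exact: DF.
rewrite (DintD cD); [|exact: ih|exact: ih].
have : C * (E (fun y => gap (F c y, F c1 y)) + E (fun y => gap (F c y, F c2 y))) <=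
    C * (2 * (eta / 4 / C)).
  by rewrite ler_pM2l//; lra.
have -> : C * (2 * (eta / 4 / C)) = eta / 2 by field; rewrite gt_eqF.
by have := hle _ K1; have := hle _ K2; lra.
Qed.

(** The excess of the mixture splits linearly once its minimizer is fixed. The [chi] part is kept as
    it is; in the [c] part, replacing that minimizer by the one for [c] can only increase the
    value. *)
Lemma excess_segment c chi t : K c -> K chi -> 0 < t -> t < 1 ->
  excess (fun y => (1 - t) * c y + t * chi y) <= (1 - t) * excess c +
    t * (E chi - E (fun y => chi (F (fun z => (1 - t) * c z + t * chi z) y))).
Proof.
move=> Kc Kchi t0 t1; set c' := fun y => (1 - t) * c y + t * chi y.
have Kc' : K c' by exact: Kconv.
have -> : excess c' = (1 - t) * E (fun y => c y - c (F c' y)) +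
                      t * (E chi - E (fun y => chi (F c' y))).
  rewrite -(DintB cD); [|exact: iK|exact: iKF].
  rewrite -!(DintZ cD)//; try by apply: (DintegrableB cD); [exact: iK|exact: iKF].
  rewrite -(DintD cD); try by apply: (DintegrableZ cD); apply: (DintegrableB cD);
    [exact: iK|exact: iKF].
  by apply: Dint_eq => y _; rewrite /c'; lra.
rewrite lerD2r ler_pM2l ?subr_gt0//.
apply: (Dint_le cD).
- by apply: (DintegrableB cD); [exact: iK|exact: iKF].
- by apply: (DintegrableB cD); [exact: iK|exact: iKF].
- move=> y Dy; rewrite lerB//.
  by rewrite (le_trans _ (Kle Kc Kc' Dy))// lerDl gap0//; exact: DF.
Qed.

(* Compares [c] with the nearby cost [(1 - t) c + t chi] for small [t]. *)
Lemma near_minimizers_optimality chi eta : K chi -> 0 < eta ->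
  exists2 e, 0 < e & forall c, K c -> excess c <= min_excess + e ->
    min_excess <= E chi - E (fun y => chi (F c y)) + eta.
Proof.
move=> Kchi eta0.
have cchi := Kcont Kchi.
pose h (z : M * M) := `|chi z.1 - chi z.2|.
have ch : {within D `*` D, continuous h}.
  apply: within_continuous_norm.
  by apply: within_continuousB; [exact: within_continuous_fst|exact: within_continuous_snd].
have [e e0 he] : exists2 e, 0 < e & forall c1 c2, K c1 -> K c2 ->
    excess c1 <= min_excess + e -> excess c2 <= min_excess + e ->
    E (fun y => h (F c1 y, F c2 y)) <= eta / 2.
  apply: near_minimizers_close => //; last by rewrite divr_gt0.
  - by move=> x Dx; rewrite /h /= subrr normr0.
  - move=> x y z _ _ _; rewrite /h /= (distrC (chi z) (chi x)); exact: ler_distD.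
have [C hC] := within_continuous_bounded cD cchi.
have Ebd c' : K c' -> E chi - E (fun y => chi (F c' y)) <= 2 * C.
  move=> Kc'; rewrite -(DintB cD); [|exact: iK|exact: iKF].
  rewrite -[leRHS](Dint_cst cD g0D); apply: (Dint_le cD).
  - by apply: (DintegrableB cD); [exact: iK|exact: iKF].
  - exact: (Dintegrable_cst cD g0D).
  - move=> y Dy; have := hC _ Dy; have := hC _ (DF Kc' Dy).
    by rewrite !ler_norml => /andP[? ?] /andP[? ?]; lra.
have C1 : 0 < `|C| + 1 by rewrite ltr_wpDl.
(* The [chi] term contributes at most [t * (2 * C) <= e / 2], which keeps the mixture an [e]-near
   minimizer; [|C| + 1] avoids a division by zero. *)
pose t := Num.min (2^-1) (e / 4 / (`|C| + 1)).
have t0 : 0 < t by rewrite lt_min invr_gt0 ltr0n /= !divr_gt0.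
have t1 : t < 1.
  by rewrite gt_min; apply/orP; left; rewrite invf_lt1// ltr1n.
have tC : t * (2 * C) <= e / 2.
  apply: (@le_trans _ _ (t * (2 * (`|C| + 1)))).
    by rewrite ler_pM2l// ler_pM2l// (le_trans (ler_norm _))// lerDl.
  apply: (@le_trans _ _ (e / 4 / (`|C| + 1) * (2 * (`|C| + 1)))).
    by rewrite ler_pM2r ?mulr_gt0// ge_min lexx orbT.
  by rewrite le_eqVlt; apply/orP; left; apply/eqP; field; rewrite gt_eqF.
(* The first bound makes both [c] and the mixture [e]-near minimizers. The second still leaves
   [eta / 2] after the final division by [t]. *)
exists (Num.min (e / 2) (t * (eta / 2))).
  by rewrite lt_min divr_gt0//= mulr_gt0// divr_gt0.
move=> c Kc Jc.
have {}Jc : excess c <= min_excess + e / 2 /\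
            excess c <= min_excess + t * (eta / 2).
  by split; rewrite (le_trans Jc)// lerD2l ge_min lexx ?orbT.
have I0 := min_excess_ge0.
pose c' y := (1 - t) * c y + t * chi y.
have Kc' : K c' by exact: Kconv.
have seg : excess c' <= (1 - t) * excess c + t * (E chi - E (fun y => chi (F c' y))).
  exact: excess_segment.
have Ic' := min_excess_le Kc'.
have Jc0 := excess_ge0 Kc.
have tE : t * (E chi - E (fun y => chi (F c' y))) <= e / 2.
  by rewrite (le_trans _ tC)// ler_pM2l//; exact: Ebd.
have tJ : (1 - t) * excess c <= excess c.
  by rewrite ler_piMl// lerBlDr lerDl ltW.
have J'e : excess c' <= min_excess + e by move: Jc => [Jc _]; lra.
have Je : excess c <= min_excess + e by move: Jc => [Jc _]; lra.
have := he _ _ Kc Kc' Je J'e; rewrite /h /= => hle.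
have dle : E (fun y => chi (F c y)) - E (fun y => chi (F c' y)) <= eta / 2.
  rewrite -(DintB cD); [|exact: iKF|exact: iKF].
  apply: le_trans hle; apply: (Dint_le cD).
  - by apply: (DintegrableB cD); exact: iKF.
  - by apply: (@Dintegrable_pair _ _ _ _ _ cD g0D h) => //; exact: KF.
  - by move=> y _; exact: ler_norm.
have : t * min_excess <= t * (eta / 2 + (E chi - E (fun y => chi (F c' y)))).
  have tI : (1 - t) * excess c <= (1 - t) * (min_excess + t * (eta / 2)).
    by rewrite ler_pM2l ?subr_gt0//; case: Jc.
  have tt : (1 - t) * (t * (eta / 2)) <= t * (eta / 2).
    have et : 0 <= t * (eta / 2) by rewrite ltW// mulr_gt0// divr_gt0.
    by rewrite ler_piMl// lerBlDr lerDl ltW.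
  by lra.
by rewrite ler_pM2l//; lra.
Qed.

(** By [Fmin] with [z = y], the excess dominates the mean gap between [y] and [F c y], and
    [diagonal_modulus] converts this gap into [|f y - f (F c y)|]. A vanishing excess thus forces
    [F c y] towards [y]. *)
Lemma excess0_close f e : {within D, continuous f} -> 0 < e ->
  exists2 C, 0 < C & forall c, K c ->
    `|E f - E (fun y => f (F c y))| <= e + C * excess c.
Proof.
move=> cf e0.
pose h (z : M * M) := `|f z.1 - f z.2|.
have ch : {within D `*` D, continuous h}.
  apply: within_continuous_norm.
  by apply: within_continuousB; [exact: within_continuous_fst|exact: within_continuous_snd].
have hd x : D x -> h (x, x) = 0 by rewrite /h /= subrr normr0.
have [C C0 hC] := diagonal_modulus cD cgap ch gap0 gapd hd e0.
exists C => // c Kc.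
have iF : Dint (fun y => f (F c y)) by exact: (Dintegrable_comp cD g0D cf (KF Kc)).
have i1 : Dint f by exact: (Dintegrable_comp cD g0D cf (self_map_id D)).
rewrite -(DintB cD) //; apply: le_trans (le_normr_Rintegral mD _) _.
  exact: (DintegrableB cD).
rewrite -[X in _ <= X + _](Dint_cst cD g0D e) /excess -(DintZ cD); last first.
  by apply: (DintegrableB cD); [exact: iK|exact: iKF].
rewrite -(DintD cD); last 2 first.
- exact: (Dintegrable_cst cD g0D).
- by apply: (DintegrableZ cD); apply: (DintegrableB cD); [exact: iK|exact: iKF].
apply: (Dint_le cD).
- exact: (Dintegrable_pair cD g0D ch (self_map_id D) (KF Kc)).
- apply: (DintegrableD cD); first exact: (Dintegrable_cst cD g0D).
  by apply: (DintegrableZ cD); apply: (DintegrableB cD); [exact: iK|exact: iKF].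
- move=> y Dy; apply: le_trans (hC _ _ Dy (DF Kc Dy)) _.
  by rewrite lerD2l ler_pM2l// lerBrDl; exact: Fmin.
Qed.

(** [T] is obtained only as a limit of minimizers, so what is retained is the optimality inequality
    tested against every [chi] in [K]. The last clause is the degenerate case where the minimizers
    converge to the given allocation itself. *)
Theorem minimizing_sequence_limit :
  exists (c : nat -> M -> R) T G,
    [/\ forall k, K (c k),
        self_map D T,
        [/\ measurable G, G `<=` D, g0 G = 1%E & forall y, G y -> S (T y) = S y],
        forall f, {within D, continuous f} ->
          E (fun y => f (F (c k) y)) @[k --> \oo] --> E (fun y => f (T y)) &
        (forall chi, K chi -> min_excess <= E chi - E (fun y => chi (T y))) /\
        (min_excess = 0 -> forall f, {within D, continuous f} ->
          E (fun y => f (F (c k) y)) @[k --> \oo] --> E f)].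
Proof.
have /choice[e he] (k : nat) : exists e, 0 < e /\ forall c1 c2, K c1 -> K c2 ->
    excess c1 <= min_excess + e -> excess c2 <= min_excess + e ->
    E (fun y => `|F c1 y - F c2 y|) <= 1 / (2 ^ k.+1)%:R.
  have [||||e e0 eP] :=
    @near_minimizers_close (fun z => `|z.1 - z.2|) (1 / (2 ^ k.+1)%:R).
  - exact: normr_sub_within.
  - by move=> x _; rewrite subrr normr0.
  - by move=> x y z _ _ _ /=; rewrite (distrC z x); exact: ler_distD.
  - by rewrite divr_gt0// ltr0n expn_gt0.
  - by exists e.
(* The minimum over [l <= k] makes [c k] and [c k.+1] both [e k]-near minimizers, as needed for the
   [k]-th increment; the base value [1 / (k + 1)] makes the sequence minimizing. *)
pose e' k := \big[Num.min/k.+1%:R^-1]_(l < k.+1) e l.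
have e'0 k : 0 < e' k by apply: lt_bigmin => // l _; exact: (he l).1.
have e'e k l : (l <= k)%N -> e' k <= e l.
  by move=> lk; apply: (bigmin_inf (Ordinal (lk : (l < k.+1)%N))).
have /choice[c cP] k : exists c, K c /\ excess c <= min_excess + e' k.
  by have [c Kc cI] := min_excess_adherent (e'0 k); exists c.
have Kc k : K (c k) by exact: (cP k).1.
have ce k l : (l <= k)%N -> excess (c k) <= min_excess + e l.
  by move=> lk; rewrite (le_trans (cP k).2)// lerD2l e'e.
have cnear a : 0 < a -> \forall k \near \oo, excess (c k) <= min_excess + a.
  move=> a0; have := near_infty_natSinv_lt (PosNum a0); apply: filterS => k /= ka.
  rewrite (le_trans (cP k).2)// lerD2l (le_trans _ (ltW ka))//.
  exact: bigmin_le_id.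
have [T [G [sT mG GD gG FT]]] := summable_increments_cvg cD g0D
  (fun k => KF (Kc k))
  (fun k => (he k).2 _ _ (Kc k.+1) (Kc k) (ce k.+1 k (leqnSn k)) (ce k k (leqnn k))).
have Ecvg f : {within D, continuous f} ->
    E (fun y => f (F (c k) y)) @[k --> \oo] --> E (fun y => f (T y)).
  by move=> cf; exact: (cvg_Dint_comp cD g0D (fun k => KF (Kc k)) sT mG GD gG FT cf).
exists c, T, G; split => //.
  split => // y Gy.
  suff : [set z | S z = S y] (T y) by [].
  apply: (closed_cvg _ (@Sclosed y) _ _ (FT y Gy)).
  by apply: nearW => k /=; rewrite FS//; exact: GD.
split=> [chi Kchi|I0 f cf].
  apply/ler_addgt0Pr => eta eta0.
  have [a a0 aP] := near_minimizers_optimality Kchi eta0.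
  have cvE : E chi - E (fun y => chi (F (c k) y)) + eta @[k --> \oo] -->
      E chi - E (fun y => chi (T y)) + eta.
    by apply: cvgD; [apply: cvgB; [exact: cvg_cst|exact/Ecvg/Kcont]|exact: cvg_cst].
  suff : [set x | min_excess <= x] (E chi - E (fun y => chi (T y)) + eta) by [].
  apply: (closed_cvg _ (@closed_ge _ _) _ _ cvE).
  by have := cnear _ a0; apply: filterS => k /= /aP; exact.
apply/cvgrPdist_le => a a0.
have a20 : 0 < a / 2 by rewrite divr_gt0.
have [C C0 hC] := excess0_close cf a20.
have := cnear _ (divr_gt0 a20 C0); apply: filterS => k /= ck.
apply: le_trans (hC _ (Kc k)) _.
move: ck; rewrite I0 add0r ler_pdivlMr// => ck; lra.
Qed.

End minimizing_sequences.

(** * Convex functions, midpoint gaps and perturbation of strictly convex functions *)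

Section convex_cones.
Context {R : realType} {d : nat}.
Implicit Types (B : set 'rV[R]_d) (f g : 'rV[R]_d -> R).

Lemma convex_functionP B f : convex_function B f <->
  forall x y t, B x -> B y -> 0 <= t -> t <= 1 ->
    f (t *: x + (1 - t) *: y) <= t * f x + (1 - t) * f y.
Proof.
split=> [cf x y t Bx By t0 t1|cf t x y /set_mem Bx /set_mem By].
  by have := cf (Itv01 t0 t1) x y (mem_set Bx) (mem_set By).
exact: (cf x y t%:num Bx By).
Qed.

Definition convex_subset B := forall x y t, B x -> B y -> 0 <= t -> t <= 1 ->
  B (t *: x + (1 - t) *: y).

Lemma convex_cone_add B f g : convex_cone B f -> convex_cone B g ->
  convex_cone B (fun x => f x + g x).
Proof.
move=> [cf /convex_functionP vf] [cg /convex_functionP vg].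
split; first exact: within_continuousD.
apply/convex_functionP => x y t Bx By t0 t1.
by rewrite (le_trans (lerD (vf _ _ _ Bx By t0 t1) (vg _ _ _ Bx By t0 t1)))// le_eqVlt;
  apply/orP; left; apply/eqP; ring.
Qed.

Lemma convex_cone_scale B f a : 0 <= a -> convex_cone B f ->
  convex_cone B (fun x => a * f x).
Proof.
move=> a0 [cf /convex_functionP vf]; split; first exact: within_continuousZ.
apply/convex_functionP => x y t Bx By t0 t1.
rewrite (le_trans (ler_wpM2l a0 (vf _ _ _ Bx By t0 t1)))//.
by rewrite le_eqVlt; apply/orP; left; apply/eqP; ring.
Qed.

Lemma convex_cone_cst B a : convex_cone B (fun=> a).
Proof.
split; first by move=> x; exact: cvg_cst.
apply/convex_functionP => x y t _ _ _ _.
by rewrite le_eqVlt; apply/orP; left; apply/eqP; ring.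
Qed.

Lemma convex_cone_max B f g : convex_cone B f -> convex_cone B g ->
  convex_cone B (fun x => Num.max (f x) (g x)).
Proof.
move=> [cf /convex_functionP vf] [cg /convex_functionP vg].
split; first exact: within_continuous_max.
apply/convex_functionP => x y t Bx By t0 t1.
have s0 : 0 <= 1 - t by rewrite subr_ge0.
rewrite ge_max; apply/andP; split.
- apply: le_trans (vf _ _ _ Bx By t0 t1) _.
  by apply: lerD; apply: ler_wpM2l; rewrite // le_max lexx.
- apply: le_trans (vg _ _ _ Bx By t0 t1) _.
  by apply: lerD; apply: ler_wpM2l; rewrite // le_max lexx orbT.
Qed.

Lemma convex_cone_strict B f :
  {within B, continuous f} -> strictly_convex B f -> convex_cone B f.
Proof.
move=> cf sf; split => //; apply/convex_functionP => x y t Bx By.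
rewrite le_eqVlt => /predU1P[<- _|t0]; first by
  rewrite scale0r add0r subr0 scale1r mul0r add0r mul1r.
rewrite le_eqVlt => /predU1P[->|t1]; first by
  rewrite subrr scale0r addr0 scale1r mul0r mul1r addr0.
have [->|xy] := eqVneq x y; last by rewrite ltW// sf.
by rewrite -scalerDl -mulrDl addrC subrK scale1r mul1r.
Qed.

Lemma half_midpoint (x y : 'rV[R]_d) : 2^-1 *: (x + y) = 2^-1 *: x + (1 - 2^-1) *: y.
Proof.
by rewrite scalerDr (_ : 1 - 2^-1 = 2^-1 :> R)//; field.
Qed.

Lemma convex_midpoint B x y : convex_subset B -> B x -> B y -> B (2^-1 *: (x + y)).
Proof.
move=> cB Bx By; rewrite half_midpoint; apply: cB => //.
by rewrite invf_le1// ler1n.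
Qed.

Lemma convex_cone_midpoint B f x y : convex_cone B f -> B x -> B y ->
  2 * f (2^-1 *: (x + y)) <= f x + f y.
Proof.
move=> [_ /convex_functionP vf] Bx By; rewrite half_midpoint.
have h1 : (2^-1 : R) <= 1 by rewrite invf_le1// ler1n.
have h0 : 0 <= (2^-1 : R) by [].
by have := vf x y 2^-1 Bx By h0 h1; lra.
Qed.

Lemma strictly_convex_midpoint B f x y : strictly_convex B f -> B x -> B y ->
  f x + f y <= 2 * f (2^-1 *: (x + y)) -> x = y.
Proof.
move=> sf Bx By; have [//|xy] := eqVneq x y; rewrite half_midpoint => le.
have h1 : (2^-1 : R) < 1 by rewrite invf_lt1// ltr1n.
have h0 : 0 < (2^-1 : R) by rewrite invr_gt0.
by exfalso; have := @sf x y 2^-1 Bx By xy h0 h1; clear xy; lra.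
Qed.

Lemma convex_cone_half_shift B f x0 : convex_subset B -> B x0 -> convex_cone B f ->
  convex_cone B (fun x => f (2^-1 *: (x + x0))).
Proof.
move=> cB Bx0 [cf /convex_functionP vf].
have Bh x : B x -> B (2^-1 *: (x + x0)) by move=> Bx; exact: convex_midpoint.
split.
  apply: (within_comp (F := fun x => 2^-1 *: (x + x0))) cf => //.
  by apply: continuous_subspaceT => x; exact: (cvgZr (cvgD cvg_id (cvg_cst x0))).
apply/convex_functionP => x y t Bx By t0 t1.
have -> : 2^-1 *: (t *: x + (1 - t) *: y + x0) =
    t *: (2^-1 *: (x + x0)) + (1 - t) *: (2^-1 *: (y + x0)).
  by apply/rowP => j; rewrite !mxE; ring.
by apply: vf => //; exact: Bh.
Qed.

(** Twice the Jensen deficit at the midpoint. It measures strict convexity using continuity alone: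
    nonnegative for convex [f], and zero only on the diagonal for strictly convex [f]. *)
Definition midpoint_gap f (z : 'rV[R]_d * 'rV[R]_d) :=
  f z.1 + f z.2 - 2 * f (2^-1 *: (z.1 + z.2)).

Lemma midpoint_gap_continuous B f : convex_subset B -> {within B, continuous f} ->
  {within B `*` B, continuous (midpoint_gap f)}.
Proof.
move=> cB cf; apply: within_continuousB; first apply: within_continuousD.
- exact: within_continuous_fst.
- exact: within_continuous_snd.
- apply: within_continuousZ.
  apply: (@within_comp _ _ _ _ B (fun z => 2^-1 *: (z.1 + z.2)) f) => //.
    by apply: continuous_subspaceT => x; exact: (cvgZr (cvgD cvg_fst cvg_snd)).
  by move=> [x y] [/= Bx By]; exact: convex_midpoint.
Qed.

(* The convex functions [x |-> 2 f ((x + x0) / 2) - f x0] touch [f] at [x0] and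
   lie below it by the midpoint gap, which leaves room for [e * g]. *)
Lemma convex_perturbation B f g delta :
  compact B -> B !=set0 -> convex_subset B -> convex_cone B f -> strictly_convex B f ->
  {within B, continuous g} -> 0 < delta ->
  exists2 e, 0 < e & exists2 G, convex_cone B G &
    forall x, B x -> f x - e * g x - 2 * e * delta <= G x <= f x - e * g x.
Proof.
move=> cB [c0 Bc0] vB Cf sf cg d0.
have cgap := midpoint_gap_continuous vB Cf.1.
have gap0 x y : B x -> B y -> 0 <= midpoint_gap f (x, y).
  by move=> Bx By; rewrite subr_ge0; exact: convex_cone_midpoint Cf Bx By.
have gapd x y : B x -> B y -> midpoint_gap f (x, y) = 0 -> x = y.
  move=> Bx By g0; apply: (strictly_convex_midpoint sf) => //.
  by move: g0; rewrite /midpoint_gap /=; lra.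
pose h (z : 'rV[R]_d * 'rV[R]_d) := `|g z.1 - g z.2|.
have ch : {within B `*` B, continuous h}.
  apply: within_continuous_norm.
  by apply: within_continuousB; [exact: within_continuous_fst|exact: within_continuous_snd].
have hd x : B x -> h (x, x) = 0 by rewrite /h /= subrr normr0.
have [C C0 hC] := diagonal_modulus cB cgap ch gap0 gapd hd d0.
(* With this choice [e * |g x - g y|] is at most [e * delta] plus the gap of [f]. *)
pose e := C^-1; have e0 : 0 < e by rewrite invr_gt0.
exists e => //.
pose a x0 x := 2 * f (2^-1 *: (x + x0)) + (- f x0 - e * g x0 - e * delta).
have Ca x0 : B x0 -> convex_cone B (a x0).
  move=> Bx0; apply: convex_cone_add; last exact: convex_cone_cst.
  by apply: convex_cone_scale => //; exact: convex_cone_half_shift.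
have ale x0 x : B x0 -> B x -> a x0 x <= f x - e * g x.
  move=> Bx0 Bx; have := hC _ _ Bx Bx0.
  rewrite -(ler_pM2l e0) mulrDr mulrA mulVf ?gt_eqF// mul1r /h /= /midpoint_gap /= /a.
  have : e * (g x - g x0) <= e * `|g x - g x0| by rewrite ler_pM2l// ler_norm.
  by lra.
(* [k (x, x0) + e * delta] bounds the loss [f x - e * g x - a x0 x]. As [k] vanishes on the
   diagonal, the loss is at most [2 * e * delta] for [x] within [eta] of [x0]. *)
pose k z := midpoint_gap f z + e * h z.
have ck : {within B `*` B, continuous k}.
  by apply: within_continuousD => //; exact: within_continuousZ.
have kd x : B x -> k (x, x) = 0.
  move=> Bx; rewrite /k hd// mulr0 addr0 /midpoint_gap /=.
  rewrite (_ : 2^-1 *: (x + x) = x); first by lra.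
  by apply/rowP => j; rewrite !mxE; field.
have ed : 0 < e * delta / 2 by rewrite divr_gt0// mulr_gt0.
have [C' C'0 kC] : exists2 C', 0 < C' & forall x y, B x -> B y ->
    k (x, y) <= e * delta / 2 + C' * `|x - y|.
  apply: (@diagonal_modulus R _ B (fun z => `|z.1 - z.2|) k) => //.
  - exact: normr_sub_within.
  - by move=> x y _ _ /eqP; rewrite normr_eq0 subr_eq0 => /eqP.
pose eta := e * delta / 2 / C'.
have eta0 : 0 < eta by rewrite divr_gt0.
have cov : @cover_compact _ B by rewrite -compact_cover.
have [||N NB BN] := @cov 'rV[R]_d B (fun x0 => ball x0 eta).
- by move=> x0 _; exact: ball_open.
- by move=> x Bx; exists x => //; exact: ballxx.
(* Finitely many centres suffice by compactness. The base value [a c0 x] is harmless, being itself a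
   convex function below [f - e * g]. *)
pose G x := \big[Num.max/a c0 x]_(x0 <- finmap.enum_fset N) a x0 x.
exists G.
  have : {in finmap.enum_fset N, forall x0, B x0} by move=> x0 /NB /set_mem.
  rewrite /G; elim: (finmap.enum_fset N) => [_|x0 s IH sB].
    by under eq_fun do rewrite big_nil; exact: Ca.
  under eq_fun do rewrite big_cons.
  apply: convex_cone_max; first by apply/Ca/sB; rewrite mem_head.
  by apply: IH => y ys; apply: sB; rewrite in_cons ys orbT.
move=> x Bx; apply/andP; split; last first.
  rewrite /G big_seq; apply: bigmax_le; first exact: ale.
  by move=> x0 x0N; rewrite ale//; exact/set_mem/NB.
have [x0 x0N xx0] := BN x Bx.
have Bx0 : B x0 by apply/set_mem/NB.
apply: (@le_trans _ _ (a x0 x)); last first.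
  exact: (@Order.TotalTheory.le_bigmax_seq _ _ _ _ (a c0 x) x0 xpredT (a ^~ x) x0N isT).
have := kC _ _ Bx Bx0.
have : C' * `|x - x0| <= C' * eta.
  rewrite ler_pM2l// distrC; move: xx0; rewrite mx_norm_ball /ball_ /= => xx0.
  exact: ltW.
have -> : C' * eta = e * delta / 2 by rewrite /eta; field; rewrite gt_eqF.
have : e * (g x0 - g x) <= e * h (x, x0) by rewrite ler_pM2l// /h /= distrC ler_norm.
rewrite /k /midpoint_gap /= /a; lra.
Qed.

End convex_cones.

(** * Convexity and compactness of Euclidean balls *)

Section euclidean_balls.
Context {R : realType} {d : nat} (r : R) (r0 : 0 < r).
Notation B := (@centered_closed_ball R d r).

Lemma centered_closed_ballE (x : 'rV[R]_d) :
  B x <-> \sum_(j < d) x 0 j ^+ 2 <= r ^+ 2.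
Proof.
rewrite /centered_closed_ball /euclidean_norm /=.
have s0 : 0 <= \sum_(j < d) x 0 j ^+ 2 by apply: sumr_ge0 => j _; exact: sqr_ge0.
by rewrite -[X in _ <-> is_true (X <= _)]sqr_sqrtr// ler_pXn2r// ?nnegrE ?sqrtr_ge0// ltW.
Qed.

Lemma centered_closed_ball0 : B 0.
Proof.
apply/centered_closed_ballE; rewrite big1 ?sqr_ge0// => j _.
by rewrite mxE expr0n.
Qed.

Lemma centered_closed_ball_convex : convex_subset B.
Proof.
move=> x y t /centered_closed_ballE Bx /centered_closed_ballE By t0 t1.
apply/centered_closed_ballE.
have s0 : 0 <= 1 - t by rewrite subr_ge0.
apply: (@le_trans _ _ (\sum_(j < d) (t * x 0 j ^+ 2 + (1 - t) * y 0 j ^+ 2))).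
  apply: ler_sum => j _; rewrite !mxE -subr_ge0.
  have -> : t * x 0 j ^+ 2 + (1 - t) * y 0 j ^+ 2 -
      (t * x 0 j + (1 - t) * y 0 j) ^+ 2 = t * (1 - t) * (x 0 j - y 0 j) ^+ 2.
    by ring.
  by rewrite mulr_ge0 ?sqr_ge0// mulr_ge0.
rewrite big_split /= -!mulr_sumr.
have := ler_wpM2l t0 Bx; have := ler_wpM2l s0 By; lra.
Qed.

Lemma centered_closed_ball_compact : compact B.
Proof.
apply: bounded_closed_compact.
  exists r; split; first exact: num_real.
  move=> c rc x /centered_closed_ballE Bx.
  rewrite /= [leLHS]/Num.norm /= mx_normrE; apply/bigmax_leP; split.
    by rewrite ltW// (lt_trans r0).
  move=> [i j] _ /=; rewrite ord1; apply: ltW; apply: le_lt_trans rc.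
  rewrite -(ler_pXn2r (ltn0Sn 1)) ?nnegrE ?normr_ge0 ?(ltW r0)//.
  rewrite real_normK ?num_real//.
  rewrite (le_trans _ Bx)// (bigD1 j)//= lerDl.
  by apply: sumr_ge0 => k _; exact: sqr_ge0.
have -> : B = (fun x : 'rV[R]_d => \sum_(j < d) x 0 j ^+ 2) @^-1` [set t | t <= r ^+ 2].
  by apply/seteqP; split => x /centered_closed_ballE.
have cs : continuous (fun x : 'rV[R]_d => \sum_(j < d) x 0 j ^+ 2).
  apply/continuous_subspace_setT; apply: within_continuous_sum => j.
  apply: continuous_subspaceT => x.
  have cj := @coord_continuous _ _ _ 0 j x.
  exact: (cvgM cj cj).
by move/continuous_closedP : cs; apply; exact: closed_le.
Qed.

End euclidean_balls.

(** * Feasible allocations, their costs and their minimizers *)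

Section optimal_allocations.
Context {R : realType} {d p : nat} (B : set 'rV[R]_d).
Hypotheses (cB : compact B) (vB : convex_subset B).
Notation M := 'M[R]_(p, d).
Notation D := (@ball_pow R d p B).
Notation S := (@sum_components R d p).
Implicit Types (psi w : 'I_p -> 'rV[R]_d -> R).

Lemma sum_componentsE (x : M) i j : S x i j = \sum_k x k j.
Proof. by rewrite /sum_components summxE; apply: eq_bigr => k _; rewrite mxE. Qed.

Lemma continuous_sum_components : continuous S.
Proof.
apply: continuous_mx => i j x.
under eq_fun do rewrite sum_componentsE.
move: x; apply/continuous_subspace_setT; apply: within_continuous_sum => k.
by apply: continuous_subspaceT; exact: coord_continuous.
Qed.

Lemma continuous_row i : continuous (fun x : M => row i x).
Proof.
apply: continuous_mx => k j x.
by under eq_fun do rewrite mxE; exact: coord_continuous.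
Qed.

Lemma ball_pow_closed : closed D.
Proof.
have clB : closed B by exact: compact_closed.
have -> : D = \bigcap_(i : 'I_p) (row i @^-1` B).
  by apply/seteqP; split => [x Dx i _|x Dx i]; [exact: Dx|exact: Dx].
apply: closed_bigI => i _.
by have /continuous_closedP := @continuous_row i; apply.
Qed.

Lemma ball_pow_compact : compact D.
Proof.
have [c [_ cP]] := compact_bounded cB.
have Bc x : B x -> `|x| <= `|c| + 1.
  by move=> Bx; apply: (cP (`|c| + 1)) => //; rewrite ltr_pwDr// ler_norm.
(* Heine-Borel is applied to the flattened set [V] of row vectors, whose image under the continuous
   map [vec_mx] is [D]. *)
pose V := [set v : 'rV[R]_(p * d) | D (vec_mx v)].
have cv : continuous (@vec_mx R p d).
  apply: continuous_mx => i j x.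
  by under eq_fun do rewrite mxE; exact: coord_continuous.
have -> : D = (@vec_mx R p d) @` V.
  apply/seteqP; split => [x Dx|_ [v Vv <-]//].
  by exists (mxvec x); rewrite /V /= ?mxvecK.
apply: continuous_compact; first exact: continuous_subspaceT.
apply: bounded_closed_compact; last first.
  by move/continuous_closedP : cv; apply; exact: ball_pow_closed.
exists (`|c| + 1); split; first exact: num_real.
move=> e ce v Vv; rewrite /= [leLHS]/Num.norm /= mx_normrE; apply/bigmax_leP; split.
  by apply: ltW; apply: le_lt_trans ce.
move=> [k l] _ /=; rewrite ord1; apply: ltW; apply: le_lt_trans ce.
case/mxvec_indexP : l => i j.
have := Bc _ (Vv i); apply: le_trans.
by have := ler_coord_mx_norm (row i (vec_mx v)) 0 j; rewrite !mxE.
Qed.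

Lemma row_midpoint (x y : M) i :
  row i (2^-1 *: (x + y)) = 2^-1 *: (row i x + row i y).
Proof. by apply/rowP => j; rewrite !mxE. Qed.

Lemma ball_pow_midpoint x y : D x -> D y -> D (2^-1 *: (x + y)).
Proof.
move=> Dx Dy i; rewrite row_midpoint.
by apply: convex_midpoint vB (Dx i) (Dy i).
Qed.

Lemma sum_components_midpoint (x y : M) : S x = S y -> S (2^-1 *: (x + y)) = S x.
Proof.
move=> xy; apply/matrixP => i j; have := congr1 (fun z : 'rV[R]_d => z i j) xy.
rewrite /= !sum_componentsE => h.
under eq_bigr do rewrite !mxE.
by rewrite -mulr_sumr big_split /= -h; field.
Qed.

Lemma separable_cost_continuous psi : (forall i, convex_cone B (psi i)) ->
  {within D, continuous (separable_cost psi)}.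
Proof.
move=> Cpsi; apply: within_continuous_sum => i.
apply: (within_comp _ _ (Cpsi i).1); last by move=> x Dx; exact: (Dx i).
by apply: continuous_subspaceT; exact: continuous_row.
Qed.

Definition cost_gap w (z : M * M) := separable_cost w z.1 + separable_cost w z.2 -
  2 * separable_cost w (2^-1 *: (z.1 + z.2)).

Lemma cost_gapE w (x y : M) :
  cost_gap w (x, y) = \sum_i midpoint_gap (w i) (row i x, row i y).
Proof.
rewrite /cost_gap /midpoint_gap /separable_cost /= mulr_sumr -big_split -sumrB /=.
by apply: eq_bigr => i _; rewrite row_midpoint.
Qed.

Lemma cost_gap_continuous w : (forall i, convex_cone B (w i)) ->
  {within D `*` D, continuous (cost_gap w)}.
Proof.
move=> Cw; have cw := separable_cost_continuous Cw.
apply: within_continuousB; first apply: within_continuousD.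
- exact: within_continuous_fst.
- exact: within_continuous_snd.
- apply: within_continuousZ.
  apply: (@within_comp _ _ _ _ D (fun z : M * M => 2^-1 *: (z.1 + z.2))) => //.
    by apply: continuous_subspaceT => x; exact: (cvgZr (cvgD cvg_fst cvg_snd)).
  by move=> [x y] [/= Dx Dy]; exact: ball_pow_midpoint.
Qed.

Lemma midpoint_gap_ge0 f x y : convex_cone B f -> B x -> B y ->
  0 <= midpoint_gap f (x, y).
Proof. by move=> Cf Bx By; rewrite subr_ge0; exact: convex_cone_midpoint Cf Bx By. Qed.

Lemma cost_gap_ge0 w x y : (forall i, convex_cone B (w i)) -> D x -> D y ->
  0 <= cost_gap w (x, y).
Proof.
by move=> Cw Dx Dy; rewrite cost_gapE; apply: sumr_ge0 => i _; exact: midpoint_gap_ge0.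
Qed.

Lemma cost_gap_eq0 w x y : (forall i, convex_cone B (w i)) ->
  (forall i, strictly_convex B (w i)) -> D x -> D y ->
  cost_gap w (x, y) = 0 -> x = y.
Proof.
move=> Cw sw Dx Dy; rewrite cost_gapE => /eqP.
rewrite psumr_eq0 => [/allP h|i _]; last exact: midpoint_gap_ge0.
apply/row_matrixP => i; apply: (strictly_convex_midpoint (sw i)) => //.
by have /eqP := h i (mem_index_enum _); rewrite /midpoint_gap /=; lra.
Qed.

(** The gap is additive in the function, and the convex difference [f - g] contributes a nonnegative
    gap. *)
Lemma midpoint_gap_le f g x y : convex_cone B (fun z => f z - g z) -> B x -> B y ->
  midpoint_gap g (x, y) <= midpoint_gap f (x, y).
Proof.
by move=> Cfg Bx By; have := convex_cone_midpoint Cfg Bx By; rewrite /midpoint_gap /=; lra.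
Qed.

Lemma cost_gap_le psi w x y : (forall i, convex_cone B (fun z => psi i z - w i z)) ->
  D x -> D y -> cost_gap w (x, y) <= cost_gap psi (x, y).
Proof.
by move=> C Dx Dy; rewrite !cost_gapE; apply: ler_sum => i _; exact: midpoint_gap_le.
Qed.

Lemma allocations_compact x : compact (allocations B x : set M).
Proof.
have -> : (allocations B x : set M) = D `&` S @^-1` [set x] by [].
apply: compact_closedI; first exact: ball_pow_compact.
have /continuous_closedP := continuous_sum_components; apply.
exact: accessible_closed_set1 (hausdorff_accessible (@norm_hausdorff _ _)) x.
Qed.

Lemma optimal_mapP psi x : (forall i, convex_cone B (psi i)) ->
  (allocations B x : set M) !=set0 -> minimizers B psi x (optimal_map B psi x : M).
Proof.
move=> Cpsi Ax; rewrite /optimal_map.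
have cp : {within (allocations B x : set M), continuous (separable_cost psi)}.
  by apply: continuous_subspaceW (separable_cost_continuous Cpsi) => y [].
have [y /set_mem Ay ymin] := compact_EVT_min Ax (@allocations_compact x) cp.
apply: xgetPex; exists y; split => // z Az; exact: ymin (mem_set Az).
Qed.

(** The midpoint of [z] and [y] is feasible, so its cost is at least that of [y]. Hence the gap of
    [psi] at [(z, y)] is at most the cost of [z] minus that of [y], and it dominates the gap of
    [w]. *)
Lemma minimizers_gap psi w x y z :
  (forall i, convex_cone B (psi i) /\ convex_cone B (fun u => psi i u - w i u)) ->
  minimizers B psi x y -> allocations B x z ->
  separable_cost psi y + cost_gap w (z, y) <= separable_cost psi z.
Proof.
move=> Cpsi [[Dy Sy] ymin] [Dz Sz].
have := @cost_gap_le psi w z y (fun i => (Cpsi i).2) Dz Dy.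
have := ymin (2^-1 *: (z + y)) _.
have Am : allocations B x (2^-1 *: (z + y)).
  split; first exact: ball_pow_midpoint.
  by rewrite sum_components_midpoint ?Sz.
rewrite /cost_gap /= => /(_ Am).
lra.
Qed.

Lemma ball_dilE : (0 < p)%N -> ball_dil p B = S @` D.
Proof.
move=> p0; have pR : (p%:R : R) != 0 by rewrite pnatr_eq0 -lt0n.
have pR0 : (0 : R) < p%:R by rewrite ltr0n.
apply/seteqP; split => [_ [x Bx <-]|_ [y Dy <-]].
  exists (\matrix_(i, j) x 0 j).
    by move=> i; rewrite (_ : row i _ = x)//; apply/rowP => j; rewrite !mxE.
  apply/rowP => j; rewrite sum_componentsE !mxE.
  under eq_bigr do rewrite mxE.
  by rewrite sumr_const card_ord mulr_natl.
exists (p%:R^-1 *: S y); last by rewrite scalerA mulfV// scale1r.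
(* Induction on the average of the first [k] rows: the next average puts weight [1 / (k + 1)] on the
   new row. The step from [k = 0] is separate, as the empty average is not known to lie in [B]. *)
suff H k : (0 < k <= p)%N -> B (k%:R^-1 *: \sum_(i < p | (i < k)%N) row i y).
  have := H p; rewrite p0 leqnn => /(_ isT); rewrite /sum_components.
  by rewrite (eq_bigl xpredT)// => i; rewrite ltn_ord.
elim: k => [//|k IH] /andP[_ kp].
rewrite (bigD1 (Ordinal kp))//=.
rewrite (eq_bigl (fun i : 'I_p => (i < k)%N)); last first.
  by move=> i; rewrite ltnS -val_eqE /= ltn_neqAle andbC.
have [k0|k0] := eqVneq k 0%N.
  rewrite big_pred0 => [|i]; last by rewrite k0.
  by rewrite addr0 {1}k0 invr1 scale1r; exact: Dy.
have k1 : (0 < k)%N by rewrite lt0n.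
have kR : (k%:R : R) != 0 by rewrite pnatr_eq0.
have k1R : (k.+1%:R : R) != 0 by rewrite pnatr_eq0.
have t0 : 0 <= k.+1%:R^-1 :> R by rewrite invr_ge0.
have t1 : k.+1%:R^-1 <= 1 :> R by rewrite invf_le1// ler1n.
have Bk := IH _; rewrite k1 (ltnW kp) in Bk.
have := vB (Dy (Ordinal kp)) (Bk isT) t0 t1.
rewrite scalerA scalerDr; congr (B (_ + _ *: _)).
by rewrite -natr1 in k1R *; field; rewrite kR k1R.
Qed.

End optimal_allocations.

(** * Measurability of the optimal map *)

Section measurable_optimal_map.
Context {R : realType} {d p : nat} (B : set 'rV[R]_d).
Hypotheses (cB : compact B) (vB : convex_subset B).
Notation M := 'M[R]_(p, d).
Notation D := (@ball_pow R d p B).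
Notation S := (@sum_components R d p).
Context (w psi : 'I_p -> 'rV[R]_d -> R).
Hypotheses (Cw : forall i, convex_cone B (w i)) (sw : forall i, strictly_convex B (w i)).
Hypothesis Cpsi :
  forall i, convex_cone B (psi i) /\ convex_cone B (fun u => psi i u - w i u).
Notation c := (@separable_cost R d p psi).
Notation T := (optimal_map B psi : 'rV[R]_d -> M).

Let cc : {within D, continuous c}.
Proof. by apply: separable_cost_continuous => i; exact: (Cpsi i).1. Qed.

Let cD : compact D. Proof. exact: ball_pow_compact. Qed.

Let TP x : (S @` D) x -> minimizers B psi x (T x).
Proof.
by move=> [y Dy <-]; apply: optimal_mapP => // [i|]; [exact: (Cpsi i).1|exists y].
Qed.

(** Uniqueness of the minimizer: the gap of [w], a lower bound for the difference of costs, is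
    positive off the diagonal. *)
Let cost_lt (x : 'rV[R]_d) (z : M) : D z -> S z = x -> z <> T x -> c (T x) < c z.
Proof.
move=> Dz Sz zT; have Tx : minimizers B psi x (T x) by apply: TP; exists z.
have := minimizers_gap vB Cpsi Tx (conj Dz Sz).
apply: lt_le_trans; rewrite ltrDl lt_neqAle (cost_gap_ge0 Cw Dz Tx.1.1) andbT.
by apply/eqP => /esym /(cost_gap_eq0 Cw sw Dz Tx.1.1).
Qed.

Let sublevel (q : R) := D `&` c @^-1` [set t | t <= q].

Let csublevel q : compact (sublevel q).
Proof. by apply: compact_within_preimage => //; exact: closed_le. Qed.

Lemma measurable_image_sum (A : set M) : compact A -> measurable (S @` A).
Proof.
move=> cA; apply: compact_measurable_mx; apply: continuous_compact => //.
by apply: continuous_subspaceT; exact: continuous_sum_components.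
Qed.

(* [T x] avoids the closed set [C] iff some rational separates the minimal cost
   over [x] from the costs of the allocations of [x] lying in [C]. *)
Lemma measurable_optimal_map : measurable_fun setT T.
Proof.
apply: measurable_fun_closed_mx => C cC.
(* Totals that have an allocation of cost at most [q], but none in [C]. *)
pose Q (q : rat) := (S @` sublevel (ratr q)) `\` (S @` (sublevel (ratr q) `&` C)).
have cI (A : set M) : compact A -> compact (A `&` C).
  by move=> cA; exact: compact_closedI.
(* The second piece accounts for the default value [0] of [T] at totals without feasible
   allocation. *)
have -> : T @^-1` C = ((S @` D) `\` \bigcup_q Q q) `|` (~` (S @` D) `&` [set x | C 0]).
  apply/seteqP; split => [x /= CT|x].
    have [Dx|nDx] := pselect ((S @` D) x); last first.
      right; split => //; suff <- : T x = 0 by [].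
      apply: xgetPN => y [[Dy Sy] _]; apply: nDx.
      by exists y.
    left; split => // -[q _ [[z [Dz cz] Sz] nC]]; apply: nC.
    have [[DT ST] Tmin] := TP Dx.
    exists (T x) => //; split => //; split => //=.
    by apply: le_trans cz; exact: Tmin.
  case=> [[Dx nQ]|[nDx C0]] /=; last first.
    suff -> : T x = 0 by [].
    by apply: xgetPN => y [[Dy Sy] _]; apply: nDx; exists y.
  apply: contrapT => nCT; apply: nQ.
  have [[DT ST] Tmin] := TP Dx.
  suff [q [q1 q2]] : exists q : rat, c (T x) <= ratr q /\
      forall z, D z -> S z = x -> C z -> ratr q < c z.
    exists q => //; split; first by exists (T x).
    by move=> [z [[Dz cz] Cz] Sz]; have := q2 z Dz Sz Cz; rewrite ltNge => /negP; apply.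
  pose N : set M := allocations B x `&` C.
  have cN : compact N by apply: cI; exact: allocations_compact.
  have [N0|nN0] := pselect (N !=set0); last first.
    have [|q] := @rat_in_itvoo R (c (T x)) (c (T x) + 1); first by rewrite ltrDl.
    rewrite in_itv/= => /andP[q1 _]; exists q; split; first exact: ltW.
    by move=> z Dz Sz Cz; exfalso; apply: nN0; exists z.
  have ccN : {within N, continuous c}.
    by apply: continuous_subspaceW cc => z [[]].
  have [z0 /set_mem [[Dz0 Sz0] Cz0] zmin] := compact_EVT_min N0 cN ccN.
  have lt0 : c (T x) < c z0.
    by apply: cost_lt => // z0T; apply: nCT; rewrite -z0T.
  have [q] := rat_in_itvoo lt0.
  rewrite in_itv/= => /andP[q1 q2]; exists q; split; first exact: ltW.
  move=> z Dz Sz Cz; apply: lt_le_trans q2 _; apply: zmin; apply/mem_set.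
  by split.
have mD : measurable (S @` D) by exact: measurable_image_sum.
apply: measurableU.
  apply: measurableD => //; apply: bigcupT_measurable_rat => q.
  by apply: measurableD; apply: measurable_image_sum => //; exact: cI.
have [C0|nC0] := pselect (C 0).
  rewrite (_ : [set x | C 0] = setT) ?setIT; first exact: measurableC.
  by apply/seteqP; split.
rewrite (_ : [set x | C 0] = set0) ?setI0//.
by apply/seteqP; split.
Qed.

End measurable_optimal_map.

(** * Events that agree on a set of full measure *)

Section full_measure.
Context {R : realType} d (T : measurableType d) (P : probability T R).
Implicit Types A G : set T.

Lemma full_setD_null G A : measurable G -> P G = 1%E -> measurable A ->
  P (A `\` G) = 0%E.
Proof.
move=> mG G1 mA; have G0 : P (~` G) = 0%E.
  transitivity (1 - P G)%E; first exact: probability_setC.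
  by rewrite G1 subee.
apply: (subset_measure0 _ (measurableC mG) _ G0); first exact: measurableD.
by move=> y [].
Qed.

Lemma full_measure_eq G A A' : measurable G -> P G = 1%E ->
  measurable A -> measurable A' -> (forall y, G y -> A y <-> A' y) -> P A = P A'.
Proof.
move=> mG G1 mA mA' AA'.
have PI (C : set T) : measurable C -> P C = P (C `&` G).
  move=> mC; transitivity (P ((C `&` G) `|` (C `\` G))); first by rewrite setUIDK.
  transitivity (P (C `&` G) + P (C `\` G))%E; last first.
    by rewrite full_setD_null// adde0.
  apply: measureU; [exact: measurableI|exact: measurableD|].
  by apply/seteqP; split => // y [[_ Gy] [_]].
rewrite PI// [RHS]PI//; congr (P _).
by apply/seteqP; split => y [Ay Gy]; split => //; apply/AA'.
Qed.

Lemma ae_measure_eq A A' : measurable A -> measurable A' ->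
  {ae P, forall t, A t <-> A' t} -> P A = P A'.
Proof.
move=> mA mA' [N [mN N0 sN]].
apply: (@full_measure_eq (~` N)) => //; first exact: measurableC.
  transitivity (1 - P N)%E; first exact: probability_setC.
  by rewrite N0 sube0.
by move=> t Nt; apply: contrapT => h; exact/Nt/sN.
Qed.

End full_measure.

(** * Change of variables for laws of maps *)

Section transport.
Context {R : realType} {m n : nat}.
Notation M := 'M[R]_(m, n).
Context (g0 : probability M R) (D : set M).
Hypotheses (cD : compact D) (g0D : g0 D = 1%E).

Lemma mfun_of_measurable d d' (T : measurableType d) (T' : measurableType d')
    (f : T -> T') : measurable_fun setT f -> exists X : {mfun T >-> T'}, X = f :> (T -> T').
Proof.
move=> mf.
by exists (MeasurableFun.Pack (MeasurableFun.Class (isMeasurableFun.Build _ _ _ _ f mf))).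
Qed.

Let mD : measurable D. Proof. exact: compact_measurable_mx. Qed.

Let g0D_fin : (g0 D < +oo)%E. Proof. by rewrite g0D ltry. Qed.

(** Since [f] is controlled only on [A], it is extended by zero before the change of variables. The
    preimage of [A] contains [D] and differs from it by a null set. *)
Lemma Rintegral_distribution m' n' (X : {mfun M >-> 'M[R]_(m', n')})
    (A : set 'M[R]_(m', n')) (f : 'M[R]_(m', n') -> R) C :
  measurable A -> (forall y, D y -> A (X y)) -> measurable_fun A f ->
  (forall z, A z -> `|f z| <= C) ->
  \int[distribution g0 X]_(z in A) f z = \int[g0]_(y in D) f (X y).
Proof.
move=> mA DA mf fC; rewrite /Rintegral; congr fine.
have mfA : measurable_fun setT (f \_ A) by move/(measurable_restrictT _ mA) : mf.
rewrite (eq_integral (fun z => ((f \_ A) z)%:E)); last first.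
  by move=> z /set_mem Az; rewrite /patch mem_set.
have mXA : measurable (X @^-1` A).
  by rewrite -[X in measurable X]setTI; apply: measurable_funPT.
have iXA : g0.-integrable (X @^-1` A) (EFin \o ((f \_ A) \o X)).
  apply: measurable_bounded_integrable => //.
  - by apply: le_lt_trans (probability_le1 _ _) _ => //; rewrite ltry.
  - by apply: (measurable_funS measurableT) => //; apply: measurableT_comp.
  - exists C; split; first exact: num_real.
    move=> e Ce y XAy; apply: ltW; apply: le_lt_trans Ce.
    by rewrite /= /patch mem_set//; exact: fC.
rewrite /distribution integral_pushforward//; last by apply/measurable_EFinP.
rewrite (negligible_integral (N := X @^-1` A `\` D))//; last 2 first.
- exact: measurableD.
- exact: full_setD_null.
rewrite setDD (_ : _ `&` D = D); last first.
  by apply/seteqP; split => [y []//|y Dy]; split => //; exact: DA.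
by apply: eq_integral => y /set_mem Dy; rewrite /= /patch mem_set//; exact: DA.
Qed.

End transport.

(** * The comonotone dominating law *)

Section comonotone_domination.
Context {R : realType} {d p : nat} (B : set 'rV[R]_d).
Notation M := 'M[R]_(p, d).
Notation D := (@ball_pow R d p B).
Notation S := (@sum_components R d p).
Context (g0 : probability M R) (m0 : probability 'rV[R]_d R)
  (w : 'I_p -> 'rV[R]_d -> R).
Hypotheses (cB : compact B) (vB : convex_subset B) (B0 : B 0) (p0 : (0 < p)%N).
Hypotheses (g0D : g0 D = 1%E)
  (m0E : forall A : set 'rV[R]_d, measurable A -> m0 A = g0 (S @^-1` A)).
Hypotheses (Cw : forall i, convex_cone B (w i)) (sw : forall i, strictly_convex B (w i)).
Notation E h := (\int[g0]_(y in D) h y).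

Let cD : compact D. Proof. exact: ball_pow_compact. Qed.

Let mD : measurable D. Proof. exact: compact_measurable_mx. Qed.

Definition admissible_family (psi : 'I_p -> 'rV[R]_d -> R) :=
  forall i, convex_cone B (psi i) /\ convex_cone B (fun x => psi i x - w i x).

Definition admissible_cost : set (M -> R) :=
  [set c | exists2 psi, admissible_family psi & c = separable_cost psi].

(* This is [optimal_map B psi (S y)] when [c] is the separable cost of [psi]. *)
Definition best_response (c : M -> R) (y : M) : M :=
  xget 0 [set z | allocations B (S y) z /\
                  forall z', allocations B (S y) z' -> c z <= c z'].

Let mS : measurable_fun setT S.
Proof. by apply: continuous_measurable_mx; exact: continuous_sum_components. Qed.

Let optP psi y : admissible_family psi -> D y ->
  minimizers B psi (S y) (best_response (separable_cost psi) y).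
Proof.
by move=> Apsi Dy; apply: optimal_mapP => // [i|]; [exact: (Apsi i).1|exists y].
Qed.

Let self_map_best_response c : admissible_cost c -> self_map D (best_response c).
Proof.
move=> [psi Apsi ->]; split; last by move=> y Dy; exact: (optP Apsi Dy).1.1.
exact: (measurableT_comp (measurable_optimal_map cB vB Cw sw Apsi) mS).
Qed.

Let admissible_cost_w : admissible_cost (separable_cost w).
Proof.
exists w => // i; split; first exact: Cw.
rewrite (_ : (fun _ => _) = fun=> 0); first exact: convex_cone_cst.
by apply/funext => x; rewrite subrr.
Qed.

Let admissible_cost_segment c1 c2 t : admissible_cost c1 -> admissible_cost c2 ->
  0 < t -> t < 1 -> admissible_cost (fun y => (1 - t) * c1 y + t * c2 y).
Proof.
move=> [psi1 A1 ->] [psi2 A2 ->] t0 t1.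
have [s0 {}t0] : 0 <= 1 - t /\ 0 <= t by rewrite subr_ge0 !ltW.
exists (fun i x => (1 - t) * psi1 i x + t * psi2 i x).
  move=> i; split.
    by apply: convex_cone_add; apply: convex_cone_scale => //; [exact: (A1 i).1|exact: (A2 i).1].
  rewrite (_ : (fun _ => _) = (fun x => (1 - t) * (psi1 i x - w i x) +
      t * (psi2 i x - w i x))); last by apply/funext => x; ring.
  by apply: convex_cone_add; apply: convex_cone_scale => //; [exact: (A1 i).2|exact: (A2 i).2].
by apply/funext => y; rewrite /separable_cost big_split /= -!mulr_sumr.
Qed.

(** The support is closed, and it lies in the compact set [D] because the complement of [D] is open
    and null. *)
Lemma compact_support (gamma : probability M R) :
  gamma D = 1%E -> compact (support_of gamma).
Proof.
move=> gD; apply: (subclosed_compact _ cD).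
  rewrite -openC openE => x /= /existsNP[U].
  move=> /not_implyP[oU /not_implyP[Ux nU]].
  rewrite /interior nbhsE; exists U; first by split.
  by move=> z Uz /(_ U oU Uz).
move=> x sx; apply: contrapT => nDx.
have oD : open (~` D) by apply: closed_openC; exact: compact_closed.
have := sx _ oD nDx.
have -> : gamma (~` D) = 0%E; last by rewrite ltxx.
transitivity (1 - gamma D)%E; first exact: probability_setC.
by rewrite gD subee.
Qed.

Lemma in_MB_law (gamma : probability M R) :
  gamma D = 1%E -> (forall A : set 'rV[R]_d, measurable A -> gamma (S @^-1` A) = m0 A) ->
  in_MB B m0 gamma.
Proof. by move=> gD gS; split => //; split => //; exact: compact_support. Qed.

(** The total is required to be preserved only on [G], since the limit map is known to preserve it
    only almost surely. *)
Lemma in_MB_pushforward (X : {mfun M >-> M}) (G : set M) :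
  measurable G -> G `<=` D -> g0 G = 1%E -> (forall y, D y -> D (X y)) ->
  (forall y, G y -> S (X y) = S y) -> in_MB B m0 (distribution g0 X).
Proof.
move=> mG GD gG DX SX.
have mX (A : set M) : measurable A -> measurable (X @^-1` A).
  by move=> mA; rewrite -[X in measurable X]setTI; exact: measurable_funPT.
have mSA (A : set 'rV[R]_d) : measurable A -> measurable (S @^-1` A).
  by move=> mA; rewrite -[X in measurable X]setTI; exact: mS.
apply: in_MB_law.
  rewrite -[RHS]g0D; apply: (full_measure_eq mD g0D) => //; first exact: mX.
  by move=> y Dy; split => // _; exact: DX.
move=> A mA; rewrite m0E//.
apply: (full_measure_eq mG gG); [exact: (mX _ (mSA _ mA))|exact: mSA|].
by move=> y Gy; rewrite /preimage /= SX.
Qed.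

Lemma integral_pushforward_D (X : {mfun M >-> M}) f : (forall y, D y -> D (X y)) ->
  {within D, continuous f} ->
  \int[distribution g0 X]_(z in D) f z = E (fun y => f (X y)).
Proof.
move=> DX cf; have [C fC] := within_continuous_bounded cD cf.
apply: (Rintegral_distribution cD g0D mD DX _ fC).
exact: within_continuous_measurable_mx.
Qed.

(** The best response is the optimal map composed with [S], and [m0] is the law of [S] under [g0].
    Two changes of variables then identify its law with the image of [m0] by the optimal map. *)
Lemma strictly_comonotone_pushforward psi (X : {mfun M >-> M}) :
  admissible_family psi -> X = best_response (separable_cost psi) :> (M -> M) ->
  strictly_comonotone B m0 w (distribution g0 X).
Proof.
move=> Apsi XE.
have XP y : D y -> minimizers B psi (S y) (X y) by move=> Dy; rewrite XE; exact: optP.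
have DX y : D y -> D (X y) by move=> /XP[[]].
split.
  by apply: (in_MB_pushforward mD) => // y /XP[[]].
exists psi; split => // f cf.
rewrite integral_pushforward_D//.
have [C fC] := within_continuous_bounded cD cf.
have [Y YE] := mfun_of_measurable mS.
have mT := measurable_optimal_map cB vB Cw sw Apsi.
have mdil : measurable (ball_dil p B) by rewrite ball_dilE//; exact: measurable_image_sum.
have Topt x : ball_dil p B x -> D (optimal_map B psi x).
  rewrite ball_dilE// => -[y Dy <-].
  by have [[]] := XP y Dy; rewrite XE.
transitivity (\int[distribution g0 Y]_(x in ball_dil p B) f (optimal_map B psi x)).
  rewrite (@Rintegral_distribution _ _ _ _ _ cD g0D _ _ Y _ _ C) => //.
  - by apply: Dint_eq => y Dy; rewrite XE YE.
  - by move=> y Dy; rewrite ball_dilE// YE; exists y.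
  - apply: (measurable_comp mD); last exact: (measurable_funS measurableT).
      by move=> _ [x /Topt Dx <-].
    exact: within_continuous_measurable_mx.
  - by move=> x /Topt; exact: fC.
rewrite /Rintegral; congr fine; apply: eq_measure_integral => A mA _.
transitivity (g0 (Y @^-1` A)); first by [].
by rewrite YE; exact: (esym (m0E mA)).
Qed.

Let Dint_sum (I : Type) (s : seq I) (h : I -> M -> R) :
  (forall i, Dintegrable g0 D (h i)) ->
  Dintegrable g0 D (fun y => \sum_(i <- s) h i y) /\
  E (fun y => \sum_(i <- s) h i y) = \sum_(i <- s) E (h i).
Proof.
move=> ih; elim: s => [|i s [IHi IHe]].
  rewrite big_nil -[X in _ /\ _ = X](Dint_cst cD g0D 0); split; last first.
    by apply: Dint_eq => y _; rewrite big_nil.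
  rewrite (_ : (fun _ => _) = fun=> 0); first exact: (Dintegrable_cst cD g0D).
  by apply/funext => y; rewrite big_nil.
rewrite big_cons -IHe -(DintD cD)//; split; last first.
  by apply: Dint_eq => y _; rewrite big_cons.
rewrite (_ : (fun _ => _) = fun y => h i y + \sum_(j <- s) h j y).
  exact: (DintegrableD cD).
by apply/funext => y; rewrite big_cons.
Qed.

(** If strictness failed for [phi], replace a single [phi i] by a convex function close to
    [phi i - e * w i]. Domination for the new family, divided by [e], shows that [w i] does not
    decrease in mean from the identity to [T]; summing over [i] contradicts strictness for [w]. *)
Lemma strict_domination (T : M -> M) phi : self_map D T ->
  (forall psi, (forall i, convex_cone B (psi i)) ->
     E (fun y => separable_cost psi (T y)) <= E (separable_cost psi)) ->
  E (fun y => separable_cost w (T y)) < E (separable_cost w) ->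
  (forall i, convex_cone B (phi i) /\ strictly_convex B (phi i)) ->
  E (fun y => separable_cost phi (T y)) < E (separable_cost phi).
Proof.
move=> sT dom wlt Cphi; rewrite ltNge; apply/negP => phile.
have crow f i : convex_cone B f -> {within D, continuous (fun y : M => f (row i y))}.
  move=> Cf; apply: (within_comp _ _ Cf.1); last by move=> x Dx; exact: (Dx i).
  by apply: continuous_subspaceT; exact: continuous_row.
have idD := self_map_id D.
have iT f : {within D, continuous f} -> Dintegrable g0 D (fun y => f (T y)).
  by move=> cf; exact: (Dintegrable_comp cD g0D cf sT).
have i1 f : {within D, continuous f} -> Dintegrable g0 D f.
  by move=> cf; exact: (Dintegrable_comp cD g0D cf idD).
have claim i : E (fun y => w i (row i y)) <= E (fun y => w i (row i (T y))).
  apply/ler_addgt0Pr => delta2 delta20.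
  (* The perturbation loses [2 * e * delta], hence the half. *)
  have delta0 : 0 < delta2 / 2 by rewrite divr_gt0.
  have [Cphii sphii] := Cphi i.
  have [|e e0 [Gi CG Gle]] := convex_perturbation cB _ vB Cphii sphii (Cw i).1 delta0.
    by exists 0.
  pose psi j := if j == i then Gi else phi j.
  have Cpsi j : convex_cone B (psi j).
    by rewrite /psi; case: ifPn => // _; exact: (Cphi j).1.
  have psiE y : separable_cost psi y =
      separable_cost phi y - phi i (row i y) + Gi (row i y).
    rewrite /separable_cost (bigD1 i)//= [in RHS](bigD1 i)//= /psi eqxx.
    rewrite (eq_bigr (fun j => phi j (row j y))); first by ring.
    by move=> j /negbTE ->.
  have cphi : {within D, continuous (separable_cost phi)}.
    by apply: separable_cost_continuous => j; exact: (Cphi j).1.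
  have cpsi := separable_cost_continuous Cpsi.
  have cwi := crow _ i (Cw i).
  have lo : E (fun y => separable_cost phi (T y)) - e * E (fun y => w i (row i (T y))) -
      2 * e * (delta2 / 2) <= E (fun y => separable_cost psi (T y)).
    rewrite -(DintZ cD); last exact: (iT _ cwi).
    rewrite -(DintB cD); [|exact: iT|by apply: (DintegrableZ cD); exact: (iT _ cwi)].
    rewrite -[X in _ - X <= _](Dint_cst cD g0D) -(DintB cD); last 2 first.
    - apply: (DintegrableB cD); first exact: iT.
      by apply: (DintegrableZ cD); exact: (iT _ cwi).
    - exact: (Dintegrable_cst cD g0D).
    apply: (Dint_le cD); last 2 first.
    - exact: iT.
    - move=> y Dy; rewrite psiE.
      by have /andP[+ _] := Gle _ (sT.2 _ Dy i); lra.
    - apply: (DintegrableB cD); last exact: (Dintegrable_cst cD g0D).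
      apply: (DintegrableB cD); first exact: iT.
      by apply: (DintegrableZ cD); exact: (iT _ cwi).
  have hi : E (separable_cost psi) <=
      E (separable_cost phi) - e * E (fun y => w i (row i y)).
    rewrite -(DintZ cD); last exact: (i1 _ cwi).
    rewrite -(DintB cD); [|exact: i1|by apply: (DintegrableZ cD); exact: (i1 _ cwi)].
    apply: (Dint_le cD); first exact: i1.
    - apply: (DintegrableB cD); first exact: i1.
      by apply: (DintegrableZ cD); exact: (i1 _ cwi).
    - move=> y Dy; rewrite psiE.
      by have /andP[_] := Gle _ (Dy i); lra.
  have dm := dom _ Cpsi.
  rewrite -(ler_pM2l e0) mulrDr.
  by move: lo hi dm phile; rewrite -mulrA (mulrCA 2 e); lra.
have [_ Ew] := Dint_sum (index_enum 'I_p) (fun i => i1 _ (crow _ i (Cw i))).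
have [_ EwT] := Dint_sum (index_enum 'I_p) (fun i => iT _ (crow _ i (Cw i))).
move: wlt; rewrite /separable_cost Ew EwT ltNge => /negP; apply.
by apply: ler_sum => i _; exact: claim.
Qed.

(** Everything takes place on [M] under [g0], with the identity as the given allocation; [gamma] is
    the law under [g0] of the limit map [T]. *)
Theorem comonotone_domination : exists gamma : probability M R,
  [/\ in_M m0 gamma, comonotone B m0 w gamma, dominates B gamma g0 &
      ~ comonotone B m0 w g0 -> strictly_dominates B gamma g0].
Proof.
pose K := admissible_cost; pose cw := separable_cost_continuous Cw.
have Fmin c y z : K c -> D y -> D z -> S z = S y ->
    c (best_response c y) + cost_gap w (z, best_response c y) <= c z.
  by move=> [psi Apsi ->] Dy Dz Szy; apply: (minimizers_gap vB Apsi (optP Apsi Dy)).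
have FS c y : K c -> D y -> S (best_response c y) = S y.
  by move=> [psi Apsi ->] Dy; exact: (optP Apsi Dy).1.2.
have Kcont c : K c -> {within D, continuous c}.
  by move=> [psi Apsi ->]; apply: separable_cost_continuous => i; exact: (Apsi i).1.
have Sclosed y : closed [set z | S z = S y].
  have /continuous_closedP cS := @continuous_sum_components R d p.
  change (closed (S @^-1` [set S y])); apply: cS.
  exact: accessible_closed_set1 (hausdorff_accessible (@norm_hausdorff _ _)) (S y).
have [c [T [G [Kc sT [mG GD gG ST] Ecvg [opt ex0]]]]] :=
  minimizing_sequence_limit cD g0D (cost_gap_continuous vB Cw)
    (fun x y => @cost_gap_ge0 _ _ _ B w x y Cw)
    (fun x y => @cost_gap_eq0 _ _ _ B w x y Cw sw)
    admissible_cost_w admissible_cost_segment Kcont self_map_best_response FS Fmin Sclosed.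
set I := min_excess _ _ _ _ in opt ex0.
have I0 : 0 <= I.
  exact: (min_excess_ge0 g0 (fun x y => @cost_gap_ge0 _ _ _ B w x y Cw)
    admissible_cost_w self_map_best_response Fmin).
have [X XT] := mfun_of_measurable sT.1.
have DX y : D y -> D (X y) by rewrite XT; exact: sT.2.
have /choice[Xs XsE] k : exists Y : {mfun M >-> M}, Y = best_response (c k) :> (M -> M).
  exact: mfun_of_measurable (self_map_best_response (Kc k)).1.
have DXs k y : D y -> D (Xs k y).
  by rewrite XsE; exact: (self_map_best_response (Kc k)).2.
have gs k : strictly_comonotone B m0 w (distribution g0 (Xs k)).
  have [psi Apsi ck] := Kc k.
  by apply: (strictly_comonotone_pushforward Apsi); rewrite XsE ck.
have gammaMB : in_MB B m0 (distribution g0 X).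
  by apply: (in_MB_pushforward mG) => // y Gy; rewrite XT; exact: ST.
have EX f : {within D, continuous f} ->
    \int[distribution g0 X]_(z in D) f z = E (fun y => f (T y)).
  by move=> cf; rewrite integral_pushforward_D// XT.
have EXs f k : {within D, continuous f} ->
    \int[distribution g0 (Xs k)]_(z in D) f z = E (fun y => f (best_response (c k) y)).
  by move=> cf; rewrite integral_pushforward_D//; [rewrite XsE|exact: DXs].
have iT f : {within D, continuous f} -> Dintegrable g0 D (fun y => f (T y)).
  by move=> cf; exact: (Dintegrable_comp cD g0D cf sT).
have i1 f : {within D, continuous f} -> Dintegrable g0 D f.
  by move=> cf; exact: (Dintegrable_comp cD g0D cf (self_map_id D)).
(* Letting [s -> +oo] in the optimality condition for [w + s * phi] leaves the
   domination inequality for [phi]. *)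
have dom phi : (forall i, convex_cone B (phi i)) ->
    E (fun y => separable_cost phi (T y)) <= E (separable_cost phi).
  move=> Cphi; have cphi := separable_cost_continuous Cphi.
  rewrite leNgt; apply/negP => lt.
  set a := E (separable_cost w) - E (fun y => separable_cost w (T y)).
  set b := E (fun y => separable_cost phi (T y)) - E (separable_cost phi).
  have b0 : 0 < b by rewrite subr_gt0.
  (* With this [s], optimality reads [I <= a - s * b = a - |a| - 1 < 0], contradicting [0 <= I]. *)
  pose s := (`|a| + 1) / b.
  have s0 : 0 < s by rewrite divr_gt0// ltr_wpDl.
  have Kchi : K (fun y => separable_cost w y + s * separable_cost phi y).
    exists (fun i x => w i x + s * phi i x).
      move=> i; split.
        by apply: convex_cone_add => //; apply: convex_cone_scale => //; exact: ltW.
      rewrite (_ : (fun _ => _) = (fun x => s * phi i x)).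
        by apply: convex_cone_scale => //; exact: ltW.
      by apply/funext => x; ring.
    by apply/funext => y; rewrite /separable_cost big_split /= -mulr_sumr.
  have := opt _ Kchi.
  rewrite (DintD cD) ?(DintZ cD)//; last 3 first.
  - exact: i1.
  - exact: i1.
  - by apply: (DintegrableZ cD); exact: i1.
  rewrite (DintD cD) ?(DintZ cD)//; last 3 first.
  - exact: (iT _ cphi).
  - exact: (iT _ cw).
  - by apply: (DintegrableZ cD); exact: (iT _ cphi).
  have sb : s * b = `|a| + 1 by rewrite /s divfK// gt_eqF.
  have := ler_norm a; move: sb I0; rewrite /a /b; lra.
have domg : dominates B (distribution g0 X) g0.
  by move=> phi Cphi; rewrite EX; [exact: dom|exact: separable_cost_continuous].
exists (distribution g0 X); split => //.
- exact: gammaMB.1.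
- split => //; exists (fun k => distribution g0 (Xs k)); split => // f cf.
  by under eq_fun do rewrite EXs//; rewrite EX//; exact: Ecvg.
- move=> ncom; split => // phi Cphi.
  rewrite EX; last by apply: separable_cost_continuous => i; exact: (Cphi i).1.
  apply: strict_domination => //.
  (* If [I = 0] the same strictly comonotone laws converge to [g0], which is then comonotone.
     Otherwise optimality with [chi = w] gives a strict decrease of at least [I]. *)
  have [I00|nI] := eqVneq I 0.
    exfalso; apply: ncom; split.
      apply: in_MB_law => // A mA; exact/esym/m0E.
    exists (fun k => distribution g0 (Xs k)); split => // f cf.
    by under eq_fun do rewrite EXs//; exact: ex0.
  have Ipos : 0 < I by rewrite lt_neqAle eq_sym nI.
  by have := opt _ admissible_cost_w; lra.
Qed.

End comonotone_domination.

(** * Application to the laws of the random vectors *)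

Unset Implicit Arguments.

Theorem theorem4p5 (R : realType) (disp : measure_display)
    (Omega : measurableType disp) (P : probability Omega R)
    (d p : nat) (X : {RV P >-> 'rV[R]_d}) (XX : {RV P >-> 'M[R]_(p, d)})
    (B : set 'rV[R]_d) (r : R) (w : 'I_p -> 'rV[R]_d -> R) :
  nonatomic P -> (1 <= d)%N -> (1 <= p)%N ->
  in_Linfty P X -> in_Linfty P XX ->
  {ae P, forall t, \sum_(i < p) row i (XX t) = X t} ->
  0 < r -> B = centered_closed_ball r ->
  {ae P, forall t, forall i : 'I_p, B (row i (XX t))} ->
  (forall i, strictly_convex B (w i) /\ C1_on B (w i)) ->
  exists gamma : probability 'M[R]_(p, d) R,
    [/\ in_M (distribution P X) gamma,
        comonotone B (distribution P X) w gamma,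
        dominates B gamma (distribution P XX) &
        ~ comonotone B (distribution P X) w (distribution P XX) ->
        strictly_dominates B gamma (distribution P XX)].
Proof.
move=> _ _ p0 _ _ sumX r0 BE XXB w_sc.
have cB : compact B by rewrite BE; exact: centered_closed_ball_compact.
have vB : convex_subset B by rewrite BE; exact: centered_closed_ball_convex.
have B0 : B 0 by rewrite BE; exact: centered_closed_ball0.
have mXX (A : set 'M[R]_(p, d)) : measurable A -> measurable (XX @^-1` A).
  by move=> mA; rewrite -[X in measurable X]setTI; exact: measurable_funPT.
have mD : measurable (@ball_pow R d p B).
  by apply: compact_measurable_mx; exact: ball_pow_compact.
(* It remains to see that the law of [XX] charges only [B^p] and that its image under the sum is the
   law of [X]; both follow from almost sure identities. *)
apply: (comonotone_domination cB vB B0 p0).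
- transitivity (P setT); last exact: probability_setT.
  apply: (ae_measure_eq (mXX _ mD) measurableT).
  by apply: filterS XXB => t XXt; split => // _; exact: XXt.
- move=> A mA.
  change (P (X @^-1` A) = P (XX @^-1` (@sum_components R d p @^-1` A))).
  apply: ae_measure_eq.
  + by rewrite -[X in measurable X]setTI; exact: measurable_funPT.
  + apply: mXX; rewrite -[X in measurable X]setTI.
    by apply: (continuous_measurable_mx (@continuous_sum_components R d p)).
  + by apply: filterS sumX => t; rewrite /preimage /= /sum_components => ->.
- by move=> i; have [sc [cw _ _]] := w_sc i; exact: convex_cone_strict.
- by move=> i; exact: (w_sc i).1.
Qed.
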